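(* The following decision problem is in $\mathsf{P}$. Input: partial bijections $a_1,\dots,a_k\in I_n$. Problem: is the inverse monoid $\langle a_1,\dots,a_k,a_1^{-1},\dots,a_k^{-1},1\rangle$ factorizable?
   Context: $[n]=\{1,\dots,n\}$. $I_n$ is the monoid of all bijections between subsets of $[n]$ (partial bijections, including the empty map) under composition of partial functions; $1$ is the identity map on $[n]$, $s^{-1}$ is the inverse partial bijection of $s$, and $\langle\cdot\rangle$ denotes the subsemigroup generated. The generators are given explicitly by their action on $[n]$. For a monoid $S$, $U(S)$ is its group of units, $E(S)=\{e\in S: ee=e\}$, and $S$ is factorizable if $S=U(S)E(S)$, i.e. every element of $S$ is a product $ue$ with $u\in U(S)$ and $e\in E(S)$. $\mathsf{P}$ is the class of problems decidable by a deterministic Turing machine in polynomial time. *)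

(* Defs.v *)
From HB Require Import structures.
From mathcomp Require Import all_boot all_order all_fingroup all_algebra.

Set Implicit Arguments.
Unset Strict Implicit.
Unset Printing Implicit Defensive.

Inductive direction := MoveLeft | Stay | MoveRight.

(* A two-way infinite tape over [A], where [None] is the blank. [tape_left]
   lists the cells to the left of the head, nearest first, and [tape_right]
   those to the right; all cells beyond the two lists are blank. *)
Record tape (A : Type) := Tape {
  tape_left : seq (option A);
  tape_head : option A;
  tape_right : seq (option A)
}.

Definition blank_tape (A : Type) : tape A := Tape [::] None [::].

(* The head starts on the first letter of [w]. *)
Definition input_tape (A : Type) (w : seq A) : tape A :=
  Tape [::] (ohead w) [seq Some x | x <- behead w].

Definition tape_write (A : Type) (c : option A) (t : tape A) : tape A :=
  Tape (tape_left t) c (tape_right t).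

Definition tape_move (A : Type) (d : direction) (t : tape A) : tape A :=
  let: Tape l c r := t in
  match d with
  | MoveLeft => Tape (behead l) (head None l) (c :: r)
  | Stay => t
  | MoveRight => Tape (c :: l) (head None r) (behead r)
  end.

(* A deterministic multitape machine with input alphabet [Sigma]: it has
   [tm_aux.+1] read-write tapes, tape 0 holding the input, and tape alphabet
   {blank} + [Sigma] + [tm_work]. The halting states are those with
   [tm_verdict q = Some b]; such a state accepts if [b] and rejects otherwise. *)
Record turing_machine (Sigma : finType) := TuringMachine {
  tm_aux : nat;
  tm_work : finType;
  tm_state : finType;
  tm_start : tm_state;
  tm_verdict : tm_state -> option bool;
  tm_trans : tm_state -> {ffun 'I_tm_aux.+1 -> option (Sigma + tm_work)} ->
    tm_state * {ffun 'I_tm_aux.+1 -> option (Sigma + tm_work) * direction}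
}.

Section Runs.

Variables (Sigma : finType) (M : turing_machine Sigma).

Definition tm_config : Type :=
  tm_state M * {ffun 'I_(tm_aux M).+1 -> tape (Sigma + tm_work M)}.

Definition tm_init (w : seq Sigma) : tm_config :=
  (tm_start M,
   [ffun i => if i == ord0 then input_tape [seq inl x | x <- w]
              else blank_tape _]).

Definition tm_step (c : tm_config) : tm_config :=
  if tm_verdict c.1 is Some _ then c else
  let: (q, act) := tm_trans c.1 [ffun i => tape_head (c.2 i)] in
  (q, [ffun i => tape_move (act i).2 (tape_write (act i).1 (c.2 i))]).

Definition tm_run (t : nat) (w : seq Sigma) : tm_config :=
  iter t tm_step (tm_init w).

Definition decides_in_time (T : nat -> nat) (L : seq Sigma -> Prop) : Prop :=
  forall w : seq Sigma, exists t : nat, exists b : bool,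
    [/\ t <= T (size w), tm_verdict (tm_run t w).1 = Some b & b <-> L w].

End Runs.

Definition in_P (Sigma : finType) (L : seq Sigma -> Prop) : Prop :=
  exists (M : turing_machine Sigma) (p : {poly nat}),
    decides_in_time M (fun m => p.[m]%R) L.

Section FiniteMonoids.

Local Open Scope group_scope.

Variable M : finStarMonoidType.
Implicit Types A S : {set M}.

Definition semigroup_gen A : {set M} :=
  \bigcap_(B : {set M} | (A \subset B) && (B * B \subset B)) B.

Definition inverse_monoid_gen (a : seq M) : {set M} :=
  semigroup_gen ([set x in a] :|: [set x^-1 | x in a] :|: [set 1]).

(* For submonoids [S] of [M], that is, containing the [1] of [M]. *)
Definition units S : {set M} :=
  [set u in S | [exists v in S, (u * v == 1) && (v * u == 1)]].

Definition idempotents S : {set M} := [set e in S | e * e == e].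

Definition factorizable S : Prop := S = units S * idempotents S.

End FiniteMonoids.

(* The points 1, ..., n are represented by 'I_n = {0, ..., n - 1}. *)
Section SymmetricInverseMonoid.

Variable n : nat.

Definition partial_injective (f : {ffun 'I_n -> option 'I_n}) : bool :=
  [forall x, forall y, (f x != None) && (f x == f y) ==> (x == y)].

Record pbij := PBij {
  pbij_fun :> {ffun 'I_n -> option 'I_n};
  pbijP : partial_injective pbij_fun
}.

HB.instance Definition _ := [isSub for pbij_fun].
HB.instance Definition _ := [Finite of pbij by <:].

Implicit Types f g h : pbij.

Lemma pbij_ext f g : (forall x, f x = g x) -> f = g.
Proof. by move=> fg; apply/val_inj/ffunP. Qed.

Lemma partial_injectiveP (u : {ffun 'I_n -> option 'I_n}) :
  reflect (forall x y z, u x = Some z -> u y = Some z -> x = y)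
          (partial_injective u).
Proof.
apply: (iffP forallP) => [inj x y z ux uy | inj x].
  by apply/eqP; move/forallP/(_ y): (inj x); rewrite ux uy eqxx.
apply/forallP=> y; apply/implyP=> /andP[].
case ux: (u x) => [z|] // _ /eqP uy.
by apply/eqP/(inj x y z).
Qed.

Lemma pbij_inj f x y z : f x = Some z -> f y = Some z -> x = y.
Proof. by move/partial_injectiveP: (pbijP f) => /(_ x y z). Qed.

Fact pbij_one_subproof : partial_injective [ffun x => Some x].
Proof. by apply/partial_injectiveP=> x y z; rewrite !ffunE => -[->] [->]. Qed.

Definition pbij_one : pbij := PBij pbij_one_subproof.

Fact pbij_mul_subproof f g : partial_injective [ffun x => obind g (f x)].
Proof.
apply/partial_injectiveP=> x y z; rewrite !ffunE.
case fx: (f x) => [x'|] //= gx; case fy: (f y) => [y'|] //= gy.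
by move: fx; rewrite (pbij_inj gx gy) => fx; apply: pbij_inj fx fy.
Qed.

(* As for permutations, products are read from left to right:
   (f * g) x = g (f x). *)
Definition pbij_mul f g : pbij := PBij (pbij_mul_subproof f g).

Fact pbij_inv_subproof f :
  partial_injective [ffun y => [pick x | f x == Some y]].
Proof.
apply/partial_injectiveP=> x y z; rewrite !ffunE.
case: pickP => // a /eqP fa [az]; case: pickP => // b /eqP fb [bz].
by move: fa fb; rewrite az bz => -> [].
Qed.

Definition pbij_inv f : pbij := PBij (pbij_inv_subproof f).

Lemma pbij_invE f x y : (pbij_inv f y == Some x) = (f x == Some y).
Proof.
rewrite ffunE; case: pickP => [a /eqP fa | none]; last by rewrite none.
apply/eqP/eqP=> [[<-] // | fx].
by rewrite (pbij_inj fa fx).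
Qed.

Lemma pbij_eqSome f g :
  (forall x y, (f x == Some y) = (g x == Some y)) -> f = g.
Proof.
move=> fg; apply: pbij_ext => x; case fx: (f x) => [y|].
  by apply/esym/eqP; rewrite -fg fx.
by case gx: (g x) => [y|] //; move: (fg x y); rewrite fx gx eqxx.
Qed.

Fact pbij_mulA : associative pbij_mul.
Proof.
by move=> f g h; apply: pbij_ext => x; rewrite !ffunE; case: (f x) => //= y;
  rewrite ffunE.
Qed.

Fact pbij_mul1 : left_id pbij_one pbij_mul.
Proof. by move=> f; apply: pbij_ext => x; rewrite !ffunE. Qed.

Fact pbij_invK : involutive pbij_inv.
Proof. by move=> f; apply: pbij_eqSome => x y; rewrite !pbij_invE. Qed.

Lemma pbij_mulP f g x z :
  reflect (exists2 y, f x = Some y & g y = Some z) (pbij_mul f g x == Some z).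
Proof.
rewrite ffunE; apply: (iffP eqP) => [|[y -> //]].
by case: (f x) => //= y; exists y.
Qed.

Fact pbij_invM : {morph pbij_inv : f g / pbij_mul f g >-> pbij_mul g f}.
Proof.
move=> f g; apply: pbij_eqSome => z x; rewrite pbij_invE.
apply/pbij_mulP/pbij_mulP=> -[y fy gy]; exists y.
- by apply/eqP; rewrite pbij_invE gy.
- by apply/eqP; rewrite pbij_invE fy.
- by apply/eqP; rewrite -pbij_invE gy.
- by apply/eqP; rewrite -pbij_invE fy.
Qed.

HB.instance Definition _ :=
  isStarMonoid.Build pbij pbij_mulA pbij_mul1 pbij_invK pbij_invM.

End SymmetricInverseMonoid.

(* [inl b] is a binary digit, [inr false] a comma, [inr true] a semicolon. *)
Definition letter : finType := (bool + bool)%type.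

Definition comma : letter := inr false.
Definition semicolon : letter := inr true.

(* Binary expansion without leading zeros, least significant digit first;
   the expansion of 0 is the single digit 0. *)
Definition binary (m : nat) : seq letter :=
  [seq inl (odd (m %/ 2 ^ i)) | i <- iota 0 (trunc_log 2 m).+1].

(* 0 stands for undefined, and the point i of {1, ..., n} for itself. *)
Definition encode_value (n : nat) (v : option 'I_n) : seq letter :=
  binary (if v is Some i then i.+1 else 0).

(* The images of 1, ..., n in this order, each followed by a comma, and then
   a semicolon. *)
Definition encode_pbij (n : nat) (f : pbij n) : seq letter :=
  rcons (flatten [seq rcons (encode_value (f i)) comma | i <- enum 'I_n])
        semicolon.

Definition encode_instance (n : nat) (a : seq (pbij n)) : seq letter :=
  rcons (binary n) semicolon ++ flatten [seq encode_pbij f | f <- a].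

(* Main.v *)
(* In the monoid S generated by partial bijections, their inverses and 1, the
   units are the permutations lying in S; they are generated by the given
   generators that are permutations. An element lies in U(S)E(S) if and only if
   it is a restriction of a unit, and restrictions of units are closed under
   products and inverses, so S is factorizable if and only if each generator
   extends to a unit.

   Whether a partial bijection f extends to an element of a permutation group
   is decided by sifting. Fix a base that lists the domain of f first, and keep
   a table of group elements, at most one for each pair of a first moved base
   point and its image. Sifting divides by table elements until no table
   element agrees with the residue at its first moved base point. By the
   argument of Furst, Hopcroft and Luks the table is a strong generating set as
   soon as all generators and all products of two table elements sift to the
   identity. Adding the residues that do not sift to the identity increases the
   table, so that at most n^2 rounds are needed; f extends if and only if it
   sifts to a partial identity.

   For the time bound, encoded data are stored as trees, and trees as words on
   stacks, each stack being a tape of a Turing machine. The functions computed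
   in polynomial time by structured stack programs are closed under composition,
   branching, and folding a list as long as the intermediate values remain of
   polynomial size. *)

Require Import Defs.
From mathcomp Require Import all_boot all_fingroup all_algebra zify.

Set Implicit Arguments.
Unset Strict Implicit.
Unset Printing Implicit Defensive.

(** * Structured stack programs and Turing machines *)

(** Correctness and running time concern different data. Sifting is therefore written for an
    arbitrary carrier with a product, an inverse and a key; it is analysed on partial bijections,
    executed on lists of numbers, and [rep] translates one run into the other. The size bounds
    needed for the running time must also hold for lists that represent nothing, so they cannot come
    from group theory. They come from the fact that [mulL] and [invL] keep lengths and entries below
    a common bound, however often they are applied. Numbers are stored in unary inside the trees.
    This is affordable because an instance with at least one generator is a word longer than n. The
    syntax of the input is tested by writing out again what was read and comparing with the word. *)

Section Fragments.

Variables (K : nat) (G : finType).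

Local Notation heads := {ffun 'I_K.+1 -> option G}.
Local Notation actions := {ffun 'I_K.+1 -> option G * direction}.
Local Notation tapes := {ffun 'I_K.+1 -> tape G}.

(* A program fragment with one exit, the transition to [None]. *)
Record fragment := Fragment {
  frag_state : finType;
  frag_start : frag_state;
  frag_trans : frag_state -> heads -> option frag_state * actions
}.

Definition read (T : tapes) : heads := [ffun i => tape_head (T i)].

Definition act_on (act : actions) (T : tapes) : tapes :=
  [ffun i => tape_move (act i).2 (tape_write (act i).1 (T i))].

Inductive runs (F : fragment) : frag_state F -> tapes -> nat -> tapes -> Prop :=
| runs_exit p T act : frag_trans p (read T) = (None, act) ->
    runs p T 1 (act_on act T)
| runs_step p T q act t T' : frag_trans p (read T) = (Some q, act) ->
    runs q (act_on act T) t T' -> runs p T t.+1 T'.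

(* The top of the stack is under the head; popped cells are left blank. *)
Definition holds (t : tape G) (s : seq G) : Prop :=
  (exists j, tape_left t = nseq j None) /\
  (exists j, tape_head t :: tape_right t = map Some s ++ nseq j None).

(** The default value of [nth] makes all stacks beyond the list [sigma] empty, so that one input
    word describes the whole initial configuration. *)
Definition stacks_in (sigma : seq (seq G)) (T : tapes) : Prop :=
  forall i : 'I_K.+1, holds (T i) (nth [::] sigma i).

(** The bound is for every tape content that represents [s]; blanks left behind by earlier pops need
    not be tracked when runs are composed. *)
Definition does (F : fragment) (s s' : seq (seq G)) (t : nat) : Prop :=
  forall T, stacks_in s T -> exists t' T',
    [/\ t' <= t, runs (frag_start F) T t' T' & stacks_in s' T'].

Lemma does_le F s s' t t' : t <= t' -> does F s s' t -> does F s s' t'.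
Proof.
move=> tt' FP T /FP[u [T' [ut rT sT']]]; exists u, T'; split=> //.
exact: leq_trans ut tt'.
Qed.

Lemma holds_head t s : holds t s -> tape_head t = ohead s.
Proof. by case=> _ [j]; case: s => [|x s]; case: j => [|j] //= []. Qed.

Lemma read_stacks s T (i : 'I_K.+1) :
  stacks_in s T -> read T i = ohead (nth [::] s i).
Proof. by move=> sT; rewrite ffunE; apply: holds_head. Qed.

Definition idle (h : heads) : actions := [ffun i => (h i, Stay)].

Lemma act_on_idle T : act_on (idle (read T)) T = T.
Proof. by apply/ffunP=> i; rewrite !ffunE /=; case: (T i). Qed.

Definition act_at (i : 'I_K.+1) (x : option G) (d : direction) (h : heads) :
  actions := [ffun k => if k == i then (x, d) else (h k, Stay)].

Lemma act_on_at i x d T :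
  act_on (act_at i x d (read T)) T =
  [ffun k => if k == i then tape_move d (tape_write x (T i)) else T k].
Proof.
apply/ffunP=> k; rewrite !ffunE; case: eqP => [->|] //= _.
by case: (T k).
Qed.

Lemma stacks_in_set s T (i : 'I_K.+1) t v : stacks_in s T -> holds t v ->
  stacks_in (set_nth [::] s i v) [ffun k => if k == i then t else T k].
Proof.
move=> sT tv k; rewrite nth_set_nth ffunE /= -val_eqE /=.
by case: eqP.
Qed.

Definition pop_frag (i : 'I_K.+1) : fragment :=
  @Fragment unit tt (fun _ h => (None, act_at i None MoveRight h)).

Lemma does_pop (i : 'I_K.+1) s :
  does (pop_frag i) s (set_nth [::] s i (behead (nth [::] s i))) 1.
Proof.
move=> T sT; exists 1, (act_on (act_at i None MoveRight (read T)) T).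
split=> //; first exact: runs_exit.
rewrite act_on_at; apply: stacks_in_set => //.
case: (sT i) => -[j lj] [m hr]; split; first by exists j.+1; rewrite /= lj.
case: (nth _ s i) hr => [|x v] /=; last case=> _ ->.
  by case: m => [|[|m]] //= [_ ->]; [exists 1 | exists m.+1].
case: v => [|y v] /=; last by exists m.
by case: m => [|m]; [exists 1 | exists m.+1].
Qed.

(* The head first moves to the free cell left of the top; [g] sees a blank
   there. *)
Definition write_frag (i : 'I_K.+1) (g : heads -> option G) : fragment :=
  @Fragment bool false (fun b h =>
    if b then (None, act_at i (g h) Stay h)
    else (Some true, act_at i (h i) MoveLeft h)).

(** Only the tops of the other stacks are prescribed, which is enough for [g] to be a constant
    (push) or the top of another stack (copy). *)
Lemma does_write (i : 'I_K.+1) (g : heads -> option G) x s :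
  (forall h : heads, (forall k, k != i -> h k = ohead (nth [::] s k)) ->
     g h = Some x) ->
  does (write_frag i g) s (set_nth [::] s i (x :: nth [::] s i)) 2.
Proof.
move=> gx T sT.
pose T1 := act_on (act_at i (read T i) MoveLeft (read T)) T.
have T1E k : k != i -> T1 k = T k.
  by move=> ki; rewrite /T1 act_on_at ffunE (negPf ki).
exists 2, (act_on (act_at i (g (read T1)) Stay (read T1)) T1).
split=> //.
  by apply: (@runs_step (write_frag i g) _ _ true _ 1) => //; apply: runs_exit.
rewrite gx; last by move=> k ki; rewrite ffunE T1E // (holds_head (sT k)).
rewrite act_on_at => k; rewrite ffunE nth_set_nth /= -val_eqE /=.
case: eqP => [|/eqP ki]; last by rewrite T1E.
move=> _; rewrite /T1 act_on_at !ffunE eqxx.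
case: (sT i); case: (T i) => l c r /= [j ->] [m hr]; split;
  rewrite /tape_move /=.
  by exists j.-1; case: j.
by exists m; rewrite hr.
Qed.

Definition push_frag i x := write_frag i (fun _ => Some x).

Lemma does_push (i : 'I_K.+1) x s :
  does (push_frag i x) s (set_nth [::] s i (x :: nth [::] s i)) 2.
Proof. exact: does_write. Qed.

Definition copy_frag i j := write_frag j (fun h => h i).

Lemma does_copy (i j : 'I_K.+1) x s : i != j -> ohead (nth [::] s i) = Some x ->
  does (copy_frag i j) s (set_nth [::] s j (x :: nth [::] s j)) 2.
Proof. by move=> ij six; apply: does_write => h ->. Qed.

Definition seq_frag (F1 F2 : fragment) : fragment :=
  @Fragment (frag_state F1 + frag_state F2)%type (inl (frag_start F1))
    (fun p h => match p with
     | inl p1 => let: (q, a) := frag_trans p1 h in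
       (Some (if q is Some q' then inl q' else inr (frag_start F2)), a)
     | inr p2 => let: (q, a) := frag_trans p2 h in (omap inr q, a)
     end).

Lemma does_seq F1 F2 s1 s2 s3 t1 t2 :
  does F1 s1 s2 t1 -> does F2 s2 s3 t2 ->
  does (seq_frag F1 F2) s1 s3 (t1 + t2).
Proof.
move=> F1P F2P T1 /F1P[u1 [T2 [ut1 r1 /F2P[u2 [T3 [ut2 r2 sT3]]]]]].
exists (u1 + u2), T3; split=> //; first exact: leq_add.
have {}r2: runs (inr (frag_start F2) : frag_state (seq_frag F1 F2)) T2 u2 T3.
  elim: r2 => {T2 u2 T3 ut2 sT3 r1} [p T a tr|p T q a t T' tr _ IH].
    by apply: runs_exit => /=; rewrite tr.
  by apply: runs_step IH => /=; rewrite tr.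
change (runs (inl (frag_start F1) : frag_state (seq_frag F1 F2))
             T1 (u1 + u2) T3).
elim: r1 r2 => {T1 T2 u1 ut1} [p T a tr|p T q a t T' tr _ IH] r2.
  by apply: runs_step r2 => /=; rewrite tr.
by rewrite addSn; apply: runs_step (IH r2) => /=; rewrite tr.
Qed.

Definition if_frag (i : 'I_K.+1) (P : pred (option G)) (F1 F2 : fragment) :
  fragment :=
  @Fragment (option (frag_state F1 + frag_state F2)) None
    (fun p h => match p with
     | None => (Some (Some (if P (h i) then inl (frag_start F1)
                            else inr (frag_start F2))), idle h)
     | Some (inl p1) => let: (q, a) := frag_trans p1 h in
       (omap (fun x => Some (inl x)) q, a)
     | Some (inr p2) => let: (q, a) := frag_trans p2 h in
       (omap (fun x => Some (inr x)) q, a)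
     end).

Lemma does_if (i : 'I_K.+1) (P : pred (option G)) F1 F2 s s' t :
  (if P (ohead (nth [::] s i)) then does F1 s s' t else does F2 s s' t) ->
  does (if_frag i P F1 F2) s s' t.+1.
Proof.
move=> FP T sT.
have start F (inj : frag_state F -> frag_state (if_frag i P F1 F2)) :
    frag_trans (None : frag_state (if_frag i P F1 F2)) (read T) =
      (Some (inj (frag_start F)), idle (read T)) ->
    (forall p h, frag_trans (inj p) h =
       (omap inj (frag_trans p h).1, (frag_trans p h).2)) ->
    does F s s' t -> exists t' T', [/\ t' <= t.+1,
      runs (frag_start (if_frag i P F1 F2)) T t' T' & stacks_in s' T'].
  move=> st trans /(_ T sT)[u [T' [ut r sT']]]; exists u.+1, T'; split=> //.
  apply: (runs_step st); rewrite act_on_idle.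
  elim: r => {st T sT u ut T' sT'} [p T a tr|p T q a u T' tr _ IH].
    by apply: runs_exit; rewrite trans tr.
  by apply: runs_step IH; rewrite trans tr.
have hE := read_stacks i sT.
case: ifP FP => PE.
- apply: (start F1 (fun x => Some (inl x))); first by rewrite /= hE PE.
  by move=> p h /=; case: (frag_trans p h).
- apply: (start F2 (fun x => Some (inr x))); first by rewrite /= hE PE.
  by move=> p h /=; case: (frag_trans p h).
Qed.

Definition while_frag (i : 'I_K.+1) (P : pred (option G)) (F : fragment) :
  fragment :=
  @Fragment (option (frag_state F)) None
    (fun p h => match p with
     | None => (if P (h i) then Some (Some (frag_start F)) else None, idle h)
     | Some p1 => let: (q, a) := frag_trans p1 h in (Some q, a)
     end).

Lemma does_while_stop (i : 'I_K.+1) (P : pred (option G)) F s :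
  ~~ P (ohead (nth [::] s i)) ->
  does (while_frag i P F) s s 1.
Proof.
move=> PN T sT; exists 1, T; split=> //.
rewrite -{2}(act_on_idle T); apply: runs_exit.
by rewrite /= (read_stacks i sT) (negPf PN).
Qed.

Lemma does_while_step (i : 'I_K.+1) (P : pred (option G)) F s1 s2 s3 t1 t2 :
  P (ohead (nth [::] s1 i)) ->
  does F s1 s2 t1 -> does (while_frag i P F) s2 s3 t2 ->
  does (while_frag i P F) s1 s3 (t1 + t2).+1.
Proof.
move=> PT FP WP T1 sT1.
have [u1 [T2 [ut1 r1 /WP[u2 [T3 [ut2 r2 sT3]]]]]] := FP _ sT1.
exists (u1 + u2).+1, T3; split; rewrite ?ltnS ?leq_add //.
apply: (@runs_step (while_frag i P F) _ _ (Some (frag_start F))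
          (idle (read T1))); first by rewrite /= (read_stacks i sT1) PT.
rewrite act_on_idle.
elim: r1 r2 => {T1 T2 u1 ut1 sT1} [p T a tr|p T q a t T' tr _ IH] r2.
  by apply: runs_step r2 => /=; rewrite tr.
by rewrite addSn; apply: runs_step (IH r2) => /=; rewrite tr.
Qed.

End Fragments.

(** * From program fragments to Turing machines *)

Section FragmentMachine.

Variables (Sigma W : finType) (K : nat) (F : fragment K (Sigma + W)%type).
Variable (accept : pred (option (Sigma + W))).

Definition fragment_machine : turing_machine Sigma :=
  @TuringMachine Sigma K W (option (frag_state F) + bool)%type
    (inl (Some (frag_start F)))
    (fun q => if q is inr b then Some b else None)
    (fun q h => match q with
     | inl (Some p) => let: (p', a) := frag_trans p h in (inl p', a)
     | inl None => (inr (accept (h ord0)), idle h)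
     | inr b => (inr b, idle h)
     end).

(** The additional step is the transition that reads the top of stack 0 and turns it into a
    verdict. *)
Lemma fragment_machine_run (w : seq Sigma) s t :
  does F [:: map inl w] s t ->
  exists2 t', t' <= t.+1 &
    tm_verdict (tm_run fragment_machine t' w).1 =
      Some (accept (ohead (head [::] s))).
Proof.
pose T0 := (tm_init fragment_machine w).2.
have sT0: stacks_in [:: map inl w] T0.
  move=> i; rewrite ffunE; case: eqP => [->|/eqP i0].
    split; first by exists 0.
    by case: w {T0} => [|x w]; [exists 1 | exists 0; rewrite /= cats0].
  split; first by exists 0.
  by exists 1; case: i i0 => -[|[|i]].
case/(_ _ sT0) => u [T [ut r sT]].
pose conf q T : tm_config fragment_machine := (inl q, T).
have run_conf: iter u (@tm_step _ fragment_machine)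
    (conf (Some (frag_start F)) T0) = conf None T.
  elim: r {sT sT0 ut} => {T u} [p T' a tr|p T' q a u T tr _ IH].
    by rewrite /= /tm_step /= -/(read T') tr.
  by rewrite iterSr {2}/tm_step /= -/(read T') tr.
exists u.+1; first by rewrite ltnS.
rewrite /tm_run iterS -[tm_init _ _]/(conf (Some _) T0) run_conf /=.
by rewrite -nth0 -/(read T) (read_stacks ord0 sT).
Qed.

End FragmentMachine.

(** * Trees on stacks *)

(** Prefix words of binary trees are self-delimiting, so trees can lie on one stack without
    separators. *)
Inductive tree := Leaf | Node of tree & tree.

Fixpoint tree_size (t : tree) : nat :=
  if t is Node a b then (tree_size a + tree_size b).+1 else 1.

Lemma tree_size_gt0 t : 0 < tree_size t. Proof. by case: t. Qed.

Section TreePrograms.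

Variable Sigma : finType.

Local Notation symbol := (Sigma + option bool)%type.

Definition leaf_symbol : symbol := inr (Some false).
Definition node_symbol : symbol := inr (Some true).
(* Marks the bottom of the data that a program puts on an auxiliary stack, so
   that programs can be nested. *)
Definition mark_symbol : symbol := inr None.

Fixpoint serial (t : tree) : seq symbol :=
  if t is Node a b then node_symbol :: serial a ++ serial b
  else [:: leaf_symbol].

Definition serials (ts : seq tree) : seq symbol := flatten (map serial ts).

Lemma size_serial t : size (serial t) = tree_size t.
Proof. by elim: t => //= a IHa b IHb; rewrite size_cat IHa IHb. Qed.

Lemma mark_notin_serial t : mark_symbol \notin serial t.
Proof. by elim: t => //= a IHa b IHb; rewrite inE mem_cat !negb_or IHa IHb. Qed.

Definition tape_at k (k4 : k < 4) : 'I_4 := Ordinal k4.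

Local Notation "# k" := (@tape_at k isT) (at level 8).
Local Notation prog := (fragment 3 symbol).

Definition top_is (x : symbol) : pred (option symbol) := pred1 (Some x).

Definition skip_prog : prog := while_frag #0 pred0 (pop_frag _ #0).

Lemma does_skip s : does skip_prog s s 1.
Proof. exact: does_while_stop. Qed.

Definition stacks (a b c d : seq symbol) := [:: a; b; c; d].

Section Scan.

Variables (copy : prog) (b1 b2 : bool).

Definition pushif (b : bool) (w s : seq symbol) := if b then catrev w s else s.

Hypothesis copyP : forall x m s1 s2 s3,
  does copy (stacks (x :: m) s1 s2 s3)
    (stacks (x :: m) (pushif b1 [:: x] s1) (pushif b2 [:: x] s2) s3) 4.

(* Stack 3 counts in unary the trees that remain to be read, which tells where
   a tree in prefix order ends. *)
Definition scan_loop : prog :=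
  while_frag #3 (top_is node_symbol)
    (seq_frag (if_frag #0 (top_is node_symbol)
                 (push_frag #3 node_symbol) (pop_frag _ #3))
      (seq_frag copy (pop_frag _ #0))).

(** Reading a node replaces one tree by its two subtrees, so the induction is over forests [ts], and
    the node symbols on stack 3 number the trees still to be read. Each symbol costs 9 steps: one
    for the test, three for the counter, five for copying and removing it. *)
Lemma does_scan_loop ts m s1 s2 s3 :
  does scan_loop
    (stacks (serials ts ++ m) s1 s2
       (nseq (size ts) node_symbol ++ mark_symbol :: s3))
    (stacks m (pushif b1 (serials ts) s1) (pushif b2 (serials ts) s2)
       (mark_symbol :: s3))
    (size (serials ts) * 9 + 1).
Proof.
have [n] := ubnP (size (serials ts)).
elim: n ts s1 s2 => // n IH [|t ts] s1 s2 le_n.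
  rewrite /serials /= /pushif; case: (b1) (b2) => [] [] /=;
  exact: does_while_stop.
set w := serials (t :: ts).
have [x [us [wE us_w cnt]]] : exists x us, [/\ w = x :: serials us,
    size (serials us) < n &
    if x == node_symbol then size us = (size ts).+2
    else size us = size ts].
  case: t @w le_n => [|a b] w le_n.
    by exists leaf_symbol, ts; split.
  exists node_symbol, (a :: b :: ts); split=> //.
    by rewrite /w /serials /= -!catA.
  by move: le_n; rewrite /w /serials /= -!catA.
have pushE b s : pushif b (x :: serials us) s =
    pushif b (serials us) (pushif b [:: x] s) by case: b.
rewrite wE !pushE.
pose cnt_us := nseq (size us) node_symbol ++ mark_symbol :: s3.
apply: (@does_le _ _ _ _ _ (8 + (size (serials us) * 9 + 1)).+1).
  by rewrite [size (_ :: _)]/=; lia.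
apply: (@does_while_step _ _ _ _ _ _ (stacks (serials us ++ m)
   (pushif b1 [:: x] s1) (pushif b2 [:: x] s2) cnt_us)) => //; last exact: IH.
apply: (@does_seq _ _ _ _ _ (stacks (x :: serials us ++ m) s1 s2 cnt_us) _ 3 5).
  apply: (@does_if _ _ _ _ _ _ _ _ 2); rewrite /top_is /=.
  rewrite -[Some x == _]/(x == node_symbol) /cnt_us; case: ifP cnt => _ ->.
    exact: does_push.
  by apply: (@does_le _ _ _ _ _ 1) => //; apply: does_pop.
apply: (@does_seq _ _ _ _ _ _ _ 4 1); first exact: copyP.
exact: does_pop.
Qed.

Definition scan : prog :=
  seq_frag (push_frag #3 mark_symbol)
    (seq_frag (push_frag #3 node_symbol)
      (seq_frag scan_loop (pop_frag _ #3))).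

Lemma does_scan t m s1 s2 s3 :
  does scan (stacks (serial t ++ m) s1 s2 s3)
    (stacks m (pushif b1 (serial t) s1) (pushif b2 (serial t) s2) s3)
    (tree_size t * 9 + 6).
Proof.
apply: (@does_le _ _ _ _ _ (2 + (2 + ((tree_size t * 9 + 1) + 1)))); first lia.
apply: does_seq; first exact: does_push.
apply: does_seq; first exact: does_push.
apply: (@does_seq _ _ _ _ _ (stacks m (pushif b1 (serial t) s1)
  (pushif b2 (serial t) s2) (mark_symbol :: s3))); last exact: does_pop.
have := @does_scan_loop [:: t] m s1 s2 s3.
by rewrite /serials /= cats0 size_serial.
Qed.

End Scan.

(** Moving symbol by symbol reverses the word; moving back reverses it again and stops at the mark,
    which no serialised tree contains. *)
Definition saved (t : tree) (s : seq symbol) : seq symbol :=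
  catrev (serial t) (mark_symbol :: s).

Definition drop_prog : prog := scan skip_prog.

Lemma does_drop t m s1 s2 s3 :
  does drop_prog (stacks (serial t ++ m) s1 s2 s3) (stacks m s1 s2 s3)
    (tree_size t * 9 + 6).
Proof.
apply: (@does_scan _ false false) => *.
by apply: (@does_le _ _ _ _ _ 1) => //; apply: does_skip.
Qed.

Definition save1_prog : prog :=
  seq_frag (push_frag #1 mark_symbol) (scan (copy_frag _ #0 #1)).

Lemma does_save1 t m s1 s2 s3 :
  does save1_prog (stacks (serial t ++ m) s1 s2 s3)
    (stacks m (saved t s1) s2 s3) (tree_size t * 9 + 8).
Proof.
apply: (@does_le _ _ _ _ _ (2 + (tree_size t * 9 + 6))); first lia.
apply: does_seq; first exact: does_push.
apply: (@does_scan _ true false) => *.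
by apply: (@does_le _ _ _ _ _ 2) => //; apply: does_copy.
Qed.

Definition save2_prog : prog :=
  seq_frag (push_frag #2 mark_symbol) (scan (copy_frag _ #0 #2)).

Lemma does_save2 t m s1 s2 s3 :
  does save2_prog (stacks (serial t ++ m) s1 s2 s3)
    (stacks m s1 (saved t s2) s3) (tree_size t * 9 + 8).
Proof.
apply: (@does_le _ _ _ _ _ (2 + (tree_size t * 9 + 6))); first lia.
apply: does_seq; first exact: does_push.
apply: (@does_scan _ false true) => *.
by apply: (@does_le _ _ _ _ _ 2) => //; apply: does_copy.
Qed.

Definition save12_prog : prog :=
  seq_frag (push_frag #1 mark_symbol) (seq_frag (push_frag #2 mark_symbol)
    (scan (seq_frag (copy_frag _ #0 #1) (copy_frag _ #0 #2)))).

Lemma does_save12 t m s1 s2 s3 :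
  does save12_prog (stacks (serial t ++ m) s1 s2 s3)
    (stacks m (saved t s1) (saved t s2) s3) (tree_size t * 9 + 10).
Proof.
apply: (@does_le _ _ _ _ _ (2 + (2 + (tree_size t * 9 + 6)))); first lia.
apply: does_seq; first exact: does_push.
apply: does_seq; first exact: does_push.
apply: (@does_scan _ true true) => *.
by apply: (@does_seq _ _ _ _ _ _ _ 2 2); apply: does_copy.
Qed.

Definition restore_prog (j : 'I_4) : prog :=
  seq_frag
    (while_frag j (predC (top_is mark_symbol))
       (seq_frag (copy_frag _ j #0) (pop_frag _ j)))
    (pop_frag _ j).

Lemma does_restore1 t m s1 s2 s3 :
  does (restore_prog #1) (stacks m (saved t s1) s2 s3)
    (stacks (serial t ++ m) s1 s2 s3) (tree_size t * 4 + 2).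
Proof.
apply: (@does_le _ _ _ _ _ ((tree_size t * 4 + 1) + 1)); first lia.
apply: (@does_seq _ _ _ _ _ (stacks (serial t ++ m) (mark_symbol :: s1) s2 s3));
  last exact: does_pop.
rewrite /saved catrevE -size_serial -(size_rev (serial t)).
have := mark_notin_serial t; rewrite -mem_rev.
have -> : serial t ++ m = catrev (rev (serial t)) m by rewrite catrevE revK.
elim: (rev (serial t)) m => [|x w IH] m /=.
  by move=> _; apply: does_while_stop.
rewrite inE negb_or eq_sym => /andP[xm wm].
apply: (@does_le _ _ _ _ _ (3 + (size w * 4 + 1)).+1); first lia.
apply: (@does_while_step _ _ _ _ _ _
  (stacks (x :: m) (w ++ mark_symbol :: s1) s2 s3)) => //; last exact: IH.
apply: (@does_seq _ _ _ _ _
  (stacks (x :: m) (x :: w ++ mark_symbol :: s1) s2 s3) _ 2 1).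
  exact: does_copy.
exact: does_pop.
Qed.

Lemma does_restore2 t m s1 s2 s3 :
  does (restore_prog #2) (stacks m s1 (saved t s2) s3)
    (stacks (serial t ++ m) s1 s2 s3) (tree_size t * 4 + 2).
Proof.
apply: (@does_le _ _ _ _ _ ((tree_size t * 4 + 1) + 1)); first lia.
apply: (@does_seq _ _ _ _ _ (stacks (serial t ++ m) s1 (mark_symbol :: s2) s3));
  last exact: does_pop.
rewrite /saved catrevE -size_serial -(size_rev (serial t)).
have := mark_notin_serial t; rewrite -mem_rev.
have -> : serial t ++ m = catrev (rev (serial t)) m by rewrite catrevE revK.
elim: (rev (serial t)) m => [|x w IH] m /=.
  by move=> _; apply: does_while_stop.
rewrite inE negb_or eq_sym => /andP[xm wm].
apply: (@does_le _ _ _ _ _ (3 + (size w * 4 + 1)).+1); first lia.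
apply: (@does_while_step _ _ _ _ _ _
  (stacks (x :: m) s1 (w ++ mark_symbol :: s2) s3)) => //; last exact: IH.
apply: (@does_seq _ _ _ _ _
  (stacks (x :: m) s1 (x :: w ++ mark_symbol :: s2) s3) _ 2 1).
  exact: does_copy.
exact: does_pop.
Qed.

(** The other stacks hold arbitrary data and are returned intact; hence a program can run while its
    caller has trees saved there, as in [dip_prog]. *)
Definition tdoes (F : prog) (ts ts' : seq tree) (n : nat) : Prop :=
  forall s1 s2 s3,
    does F (stacks (serials ts) s1 s2 s3) (stacks (serials ts') s1 s2 s3) n.

Lemma tdoes_le F ts ts' n n' : n <= n' -> tdoes F ts ts' n -> tdoes F ts ts' n'.
Proof. by move=> le_n FP s1 s2 s3; apply: does_le le_n (FP _ _ _). Qed.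

Lemma tdoes_seq F1 F2 ts1 ts2 ts3 n1 n2 :
  tdoes F1 ts1 ts2 n1 -> tdoes F2 ts2 ts3 n2 ->
  tdoes (seq_frag F1 F2) ts1 ts3 (n1 + n2).
Proof. by move=> F1P F2P s1 s2 s3; apply: does_seq. Qed.

Lemma tdoes_drop t ts : tdoes drop_prog (t :: ts) ts (tree_size t * 9 + 6).
Proof. by move=> *; apply: does_drop. Qed.

Definition cons_prog : prog := push_frag #0 node_symbol.

Lemma tdoes_cons a b ts : tdoes cons_prog (a :: b :: ts) (Node a b :: ts) 2.
Proof. by move=> s1 s2 s3; rewrite /serials /= -catA; apply: does_push. Qed.

Definition uncons_prog : prog := pop_frag _ #0.

Lemma tdoes_uncons a b ts : tdoes uncons_prog (Node a b :: ts) (a :: b :: ts) 1.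
Proof. by move=> s1 s2 s3; rewrite /serials /= -catA; apply: does_pop. Qed.

Definition leaf_prog : prog := push_frag #0 leaf_symbol.

Lemma tdoes_leaf ts : tdoes leaf_prog ts (Leaf :: ts) 2.
Proof. by move=> s1 s2 s3; apply: does_push. Qed.

Definition dup_prog : prog :=
  seq_frag save12_prog (seq_frag (restore_prog #1) (restore_prog #2)).

Lemma tdoes_dup t ts :
  tdoes dup_prog (t :: ts) (t :: t :: ts) (tree_size t * 17 + 14).
Proof.
move=> s1 s2 s3; apply: (@does_le _ _ _ _ _
  ((tree_size t * 9 + 10) +
    ((tree_size t * 4 + 2) + (tree_size t * 4 + 2)))); first lia.
apply: does_seq; first exact: does_save12.
apply: does_seq; [exact: does_restore1 | exact: does_restore2].
Qed.

Definition swap_prog : prog :=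
  seq_frag save1_prog (seq_frag save2_prog
    (seq_frag (restore_prog #1) (restore_prog #2))).

Lemma tdoes_swap a b ts :
  tdoes swap_prog (a :: b :: ts) (b :: a :: ts)
    ((tree_size a + tree_size b) * 13 + 20).
Proof.
move=> s1 s2 s3; apply: (@does_le _ _ _ _ _
  ((tree_size a * 9 + 8) + ((tree_size b * 9 + 8) +
    ((tree_size a * 4 + 2) + (tree_size b * 4 + 2))))); first lia.
apply: does_seq; first exact: does_save1.
apply: does_seq; first exact: does_save2.
apply: does_seq; [exact: does_restore1 | exact: does_restore2].
Qed.

Definition dip_prog (F : prog) : prog :=
  seq_frag save1_prog (seq_frag F (restore_prog #1)).

Lemma tdoes_dip F t ts ts' n : tdoes F ts ts' n ->
  tdoes (dip_prog F) (t :: ts) (t :: ts') (tree_size t * 13 + 10 + n).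
Proof.
move=> FP s1 s2 s3; apply: (@does_le _ _ _ _ _
  ((tree_size t * 9 + 8) + (n + (tree_size t * 4 + 2)))); first lia.
apply: does_seq; first exact: does_save1.
apply: does_seq; [exact: FP | exact: does_restore1].
Qed.

Definition is_node (t : tree) : bool := if t is Node _ _ then true else false.

Lemma top_is_node t ts :
  top_is node_symbol (ohead (serials (t :: ts))) = is_node t.
Proof. by case: t. Qed.

Definition ifnode_prog (F1 F2 : prog) : prog :=
  if_frag #0 (top_is node_symbol) F1 F2.

Lemma tdoes_ifnode F1 F2 t ts ts' n :
  (if is_node t then tdoes F1 (t :: ts) ts' n else tdoes F2 (t :: ts) ts' n) ->
  tdoes (ifnode_prog F1 F2) (t :: ts) ts' n.+1.
Proof.
move=> FP s1 s2 s3; apply: does_if; rewrite top_is_node.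
by case: (is_node t) FP => FP; apply: FP.
Qed.

Definition whilenode_prog (F : prog) : prog :=
  while_frag #0 (top_is node_symbol) F.

Lemma tdoes_whilenode_stop F ts :
  tdoes (whilenode_prog F) (Leaf :: ts) (Leaf :: ts) 1.
Proof. by move=> s1 s2 s3; apply: does_while_stop. Qed.

Lemma tdoes_whilenode_step F a b ts1 ts2 ts3 n1 n2 :
  tdoes F (Node a b :: ts1) ts2 n1 -> tdoes (whilenode_prog F) ts2 ts3 n2 ->
  tdoes (whilenode_prog F) (Node a b :: ts1) ts3 (n1 + n2).+1.
Proof.
by move=> FP WP s1 s2 s3; apply: does_while_step (FP _ _ _) (WP _ _ _).
Qed.

End TreePrograms.

(** * Functions computable in polynomial time *)

Class encodable (X : Type) := enc : X -> tree.

Definition esize {X} {eX : encodable X} (x : X) : nat := tree_size (enc x).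

#[global] Instance enc_unit : encodable unit := fun _ => Leaf.
(** A Boolean, like the emptiness of a list, is decided by the root symbol alone. *)
#[global] Instance enc_bool : encodable bool :=
  fun b => if b then Node Leaf Leaf else Leaf.
#[global] Instance enc_pair X Y {eX : encodable X} {eY : encodable Y} :
  encodable (X * Y) := fun p => Node (enc p.1) (enc p.2).
#[global] Instance enc_sum X Y {eX : encodable X} {eY : encodable Y} :
  encodable (X + Y) :=
  fun s => match s with inl x => enc (false, x) | inr y => enc (true, y) end.
#[global] Instance enc_seq X {eX : encodable X} : encodable (seq X) :=
  fun s => foldr (fun x t => Node (enc x) t) Leaf s.
(** Unary, so that a size bound is a bound on the value and the successor is a list constructor. *)
#[global] Instance enc_nat : encodable nat := fun n => enc (nseq n tt).
#[global] Instance enc_letter : encodable letter :=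
  fun c => enc (c : bool + bool).

Arguments esize : simpl never.
Arguments enc : simpl never.

Lemma esize_gt0 X {eX : encodable X} (x : X) : 0 < esize x.
Proof. exact: tree_size_gt0. Qed.

Lemma esize_pair X Y {eX : encodable X} {eY : encodable Y} (x : X) (y : Y) :
  esize (x, y) = (esize x + esize y).+1.
Proof. by []. Qed.

Lemma esize_nil X {eX : encodable X} : esize ([::] : seq X) = 1.
Proof. by []. Qed.

Lemma esize_cons X {eX : encodable X} (x : X) s :
  esize (x :: s) = (esize x + esize s).+1.
Proof. by []. Qed.

Lemma esize_nat (n : nat) : esize n = n.*2.+1.
Proof.
rewrite /esize /enc /enc_nat; elim: n => //= n IH.
by rewrite /enc /= in IH *; rewrite IH.
Qed.

Lemma size_le_esize X {eX : encodable X} (s : seq X) : size s < esize s.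
Proof. by elim: s => // x s IH; rewrite esize_cons /=; lia. Qed.

Lemma esize_bool (b : bool) : esize b <= 3.
Proof. by case: b. Qed.

Lemma esize_cat X {eX : encodable X} (s1 s2 : seq X) :
  (esize (s1 ++ s2)).+1 = esize s1 + esize s2.
Proof.
elim: s1 => [|x s1 IH]; first by rewrite /= esize_nil add1n.
by rewrite cat_cons !esize_cons; lia.
Qed.

Lemma esize_mem (X : eqType) {eX : encodable X} (s : seq X) x :
  x \in s -> esize x <= esize s.
Proof.
elim: s => // y s IH; rewrite inE => /predU1P[->|/IH le_s] /=;
  rewrite esize_cons; lia.
Qed.

Lemma esize_seq_le X {eX : encodable X} (s : seq X) (m B : nat) :
  size s <= m -> (forall j, j < size s -> forall x0, esize (nth x0 s j) <= B) ->
  esize s <= m * B.+1 + 1.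
Proof.
elim: s m => [|x s IH] m; first by rewrite esize_nil; lia.
case: m => //= m le_m leB; rewrite esize_cons.
have := IH m le_m (fun j ltj => leB j.+1 ltj).
by have := leB 0 isT x => /=; lia.
Qed.

Section PolyBounds.

Context {X : Type} {eX : encodable X}.
Implicit Types u v : X -> nat.

(** Since the base is at least 2, constants, sums and products are all absorbed by a larger
    exponent. *)
Definition pbound u : Prop := exists k, forall x, u x <= (esize x).+2 ^ k.

Lemma pbound_le u v : pbound v -> (forall x, u x <= v x) -> pbound u.
Proof. by case=> k vk uv; exists k => x; apply: leq_trans (uv x) (vk x). Qed.

Lemma leq_2exp n : n <= 2 ^ n.
Proof. exact/ltnW/ltn_expl. Qed.

Lemma leq_expn m n k : m <= n -> m ^ k <= n ^ k.
Proof. by case: k => // k; rewrite leq_exp2r. Qed.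

Lemma pbound_const c : pbound (fun _ => c).
Proof.
by exists c => x; apply: leq_trans (leq_2exp c) _; apply: leq_expn.
Qed.

Lemma pbound_size : pbound esize.
Proof. by exists 1 => x; rewrite expn1 -addn2 leq_addr. Qed.

Lemma pbound_mul u v : pbound u -> pbound v -> pbound (fun x => u x * v x).
Proof.
by case=> j uj [k vk]; exists (j + k) => x; rewrite expnD leq_mul.
Qed.

Lemma pbound_add u v : pbound u -> pbound v -> pbound (fun x => u x + v x).
Proof.
case=> j uj [k vk]; exists (j + k).+1 => x.
apply: leq_trans (leq_add (uj x) (vk x)) _.
rewrite expnS expnD.
have a0: 0 < (esize x).+2 ^ j by rewrite expn_gt0.
have b0: 0 < (esize x).+2 ^ k by rewrite expn_gt0.
move: (_ ^ j) (_ ^ k) a0 b0 => a b a0 b0.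
apply: (@leq_trans (2 * (a * b))); last by rewrite leq_mul.
have := leq_pmulr a b0; have := leq_pmull b a0; lia.
Qed.

Lemma pbound_exp u k : pbound u -> pbound (fun x => u x ^ k).
Proof.
move=> uP; elim: k => [|k IH]; first exact: pbound_const 1.
by apply: pbound_le (pbound_mul uP IH) _ => x; rewrite expnS.
Qed.

End PolyBounds.

Lemma pbound_comp X Y {eX : encodable X} {eY : encodable Y}
    (f : X -> Y) (v : Y -> nat) :
  pbound v -> pbound (fun x => esize (f x)) -> pbound (fun x => v (f x)).
Proof.
case=> k vk fP.
apply: pbound_le (pbound_exp k (pbound_add fP (pbound_const 2))) _.
by move=> x; rewrite addn2; apply: vk.
Qed.

(** The size clause turns a time bound in terms of [f x] into one in terms of [x] when functions are
    composed. The quantifier over [Sigma] is there because the input alphabet is fixed only at the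
    very end, while the programs use nothing but tree symbols. *)
Variant ptime {X Y} {eX : encodable X} {eY : encodable Y} (f : X -> Y) : Prop :=
  Ptime of pbound (fun x => esize (f x)) &
  forall Sigma : finType, exists F : fragment 3 (Sigma + option bool)%type,
    exists2 u : X -> nat, pbound u &
    forall x ts, tdoes F (enc x :: ts) (enc (f x) :: ts) (u x).

(** * Closure under composition, pairing, constants and projections *)

Section Closure.

Context {X Y Z : Type} {eX : encodable X} {eY : encodable Y}.
Context {eZ : encodable Z}.

Lemma ptime_ext (f g : X -> Y) : f =1 g -> ptime f -> ptime g.
Proof.
move=> fg [szf fP]; split.
  by apply: pbound_le szf _ => x; rewrite fg.
move=> Sigma; have [F [u uP FP]] := fP Sigma.
by exists F, u => // x ts; rewrite -fg.
Qed.

(** Covers all changes of type that leave the tree alone: a pair read as a list cell, a number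
    paired with [tt] as its successor, a list of units as a number. *)
Lemma ptime_recode (f : X -> Y) : (forall x, enc (f x) = enc x) -> ptime f.
Proof.
move=> fE; split.
  by apply: pbound_le pbound_size _ => x; rewrite /esize fE.
move=> Sigma; exists (skip_prog _), (fun _ => 1); first exact: pbound_const.
by move=> x ts s1 s2 s3; rewrite fE; apply: does_skip.
Qed.

Lemma ptime_comp (g : Y -> Z) (f : X -> Y) :
  ptime g -> ptime f -> ptime (fun x => g (f x)).
Proof.
move=> [szg gP] [szf fP]; split; first exact: (pbound_comp szg szf).
move=> Sigma; have [F [u uP FP]] := fP Sigma; have [G [v vP GP]] := gP Sigma.
exists (seq_frag F G), (fun x => u x + v (f x)).
  by apply: pbound_add uP (pbound_comp vP szf).
by move=> x ts; apply: tdoes_seq (FP x ts) (GP _ ts).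
Qed.

Lemma ptime_pair (f : X -> Y) (g : X -> Z) :
  ptime f -> ptime g -> ptime (fun x => (f x, g x)).
Proof.
move=> [szf fP] [szg gP]; split.
  apply: pbound_le (pbound_add (pbound_add szf szg) (pbound_const 1)) _ => x.
  by rewrite esize_pair addn1.
move=> Sigma; have [F [u uP FP]] := fP Sigma; have [G [v vP GP]] := gP Sigma.
exists (seq_frag (dup_prog _)
  (seq_frag (dip_prog G) (seq_frag F (cons_prog _)))).
exists (fun x => (esize x * 17 + 14) +
          ((esize x * 13 + 10 + v x) + (u x + 2))).
  by repeat first [apply: pbound_add | apply: pbound_mul | exact: pbound_const
    | exact: pbound_size | assumption].
move=> x ts; apply: tdoes_seq; first exact: tdoes_dup.
apply: tdoes_seq; first exact/tdoes_dip/GP.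
by apply: tdoes_seq; [exact: FP | exact: tdoes_cons].
Qed.

Lemma ptime_const (y : Y) : ptime (fun _ : X => y).
Proof.
split; first exact: pbound_const.
move=> Sigma.
have [F [n FP]]: exists (F : fragment 3 (Sigma + option bool)%type) n,
    forall ts, tdoes F ts (enc y :: ts) n.
  elim: (enc y) => [|a [F [n FP]] b [G [m GP]]].
    by exists (leaf_prog _), 2 => ts; apply: tdoes_leaf.
  exists (seq_frag G (seq_frag F (cons_prog _))), (m + (n + 2)) => ts.
  apply: tdoes_seq; first exact: GP.
  by apply: tdoes_seq; [exact: FP | exact: tdoes_cons].
exists (seq_frag (drop_prog _) F), (fun x => (esize x * 9 + 6) + n).
  by repeat first [apply: pbound_add | apply: pbound_mul | exact: pbound_const
    | exact: pbound_size].
by move=> x ts; apply: tdoes_seq; [exact: tdoes_drop | exact: FP].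
Qed.

Lemma ptime_fst : ptime (fun p : X * Y => p.1).
Proof.
split.
  by apply: pbound_le pbound_size _ => -[x y] /=; rewrite esize_pair; lia.
move=> Sigma; exists (seq_frag (uncons_prog _) (dip_prog (drop_prog _))).
exists (fun p => 1 + (esize p * 13 + 10 + (esize p * 9 + 6))).
  by repeat first [apply: pbound_add | apply: pbound_mul | exact: pbound_const
    | exact: pbound_size].
move=> [x y] ts; apply: (@tdoes_le _ _ _ _
  (1 + (esize x * 13 + 10 + (esize y * 9 + 6)))).
  by rewrite esize_pair; lia.
apply: tdoes_seq; first exact: tdoes_uncons.
exact/tdoes_dip/tdoes_drop.
Qed.

Lemma ptime_snd : ptime (fun p : X * Y => p.2).
Proof.
split.
  by apply: pbound_le pbound_size _ => -[x y] /=; rewrite esize_pair; lia.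
move=> Sigma; exists (seq_frag (uncons_prog _) (drop_prog _)).
exists (fun p => 1 + (esize p * 9 + 6)).
  by repeat first [apply: pbound_add | apply: pbound_mul | exact: pbound_const
    | exact: pbound_size].
move=> [x y] ts; apply: (@tdoes_le _ _ _ _ (1 + (esize x * 9 + 6))).
  by rewrite esize_pair; lia.
by apply: tdoes_seq; [exact: tdoes_uncons | exact: tdoes_drop].
Qed.

End Closure.

Ltac pbound_tac := repeat first
  [ apply: pbound_add | apply: pbound_mul | apply: pbound_exp
  | exact: pbound_const | exact: pbound_size | assumption ].

Section Branching.

Context {X Y Z : Type} {eX : encodable X} {eY : encodable Y}.
Context {eZ : encodable Z}.

Lemma ptime_if (b : X -> bool) (f g : X -> Y) :
  ptime b -> ptime f -> ptime g -> ptime (fun x => if b x then f x else g x).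
Proof.
move=> bP [szf fP] [szg gP]; split.
  apply: pbound_le (pbound_add szf szg) _ => x.
  by case: (b x); rewrite ?leq_addr ?leq_addl.
have id_P: ptime (fun x : X => x) by apply: ptime_recode.
have [_ hP] := ptime_pair bP id_P.
move=> Sigma; have [F [u uP FP]] := fP Sigma; have [G [v vP GP]] := gP Sigma.
have [H [w wP HP]] := hP Sigma.
exists (seq_frag H (seq_frag (uncons_prog _)
  (ifnode_prog (seq_frag (drop_prog _) F) (seq_frag (drop_prog _) G)))).
(* 33 is the cost of dropping [true], a tree of size 3; it also covers the 15 steps for [false]. *)
exists (fun x => w x + (1 + (33 + u x + v x + 1))); first by pbound_tac.
move=> x ts; apply: tdoes_seq; first exact: HP.
apply: tdoes_seq; first exact: tdoes_uncons.
rewrite addn1; apply: tdoes_ifnode => /=; case: (b x) => /=.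
  apply: (@tdoes_le _ _ _ _ (33 + u x)); first lia.
  by apply: tdoes_seq; [exact: tdoes_drop | exact: FP].
apply: (@tdoes_le _ _ _ _ (15 + v x)); first lia.
by apply: tdoes_seq; [exact: tdoes_drop | exact: GP].
Qed.

(** The list [y :: s] and the pair [(y, s)] have the same tree, so [cons_prog] alone prepares the
    argument of [g]. *)
Lemma ptime_case (l : X -> seq Y) (f : X -> Z) (g : (Y * seq Y) * X -> Z) :
  ptime l -> ptime f -> ptime g ->
  ptime (fun x => if l x is y :: s then g ((y, s), x) else f x).
Proof.
move=> lP [szf fP] [szg gP].
have id_P: ptime (fun x : X => x) by apply: ptime_recode.
have [szl _] := lP; split.
  have : pbound (fun x => ((esize (l x)) + (esize x) + 1).+2).
    by apply: (@pbound_le _ _ _ (fun x => esize (l x) + esize x + 3));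
      [pbound_tac | move=> x; lia].
  case: szg => k szg szh.
  apply: pbound_le (pbound_add szf (pbound_exp k szh)) _ => x.
  case: (l x) => [|y s]; first exact: leq_addr.
  apply: leq_trans (szg _) _; apply: leq_trans (leq_addl _ _).
  by apply: leq_expn; rewrite !esize_pair esize_cons; lia.
have [_ hP] := ptime_pair lP id_P.
move=> Sigma; have [F [u uP FP]] := fP Sigma; have [G [v vP GP]] := gP Sigma.
have [H [w wP HP]] := hP Sigma.
exists (seq_frag H (seq_frag (uncons_prog _)
  (ifnode_prog (seq_frag (cons_prog _) G) (seq_frag (drop_prog _) F)))).
case: vP => k vk.
exists (fun x => w x + (1 + (15 + u x + (esize (l x) + esize x + 3) ^ k + 1))).
  by pbound_tac.
move=> x ts; apply: tdoes_seq; first exact: HP.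
apply: tdoes_seq; first exact: tdoes_uncons.
rewrite addn1; apply: tdoes_ifnode => /=; case: (l x) => [|y s] /=.
  apply: (@tdoes_le _ _ _ _ (15 + u x)); first lia.
  by apply: tdoes_seq; [exact: tdoes_drop | exact: FP].
apply: (@tdoes_le _ _ _ _ (2 + v ((y, s), x))); last first.
  by apply: tdoes_seq; [exact: tdoes_cons | exact: (GP ((y, s), x))].
have vle: v ((y, s), x) <= (esize (y :: s) + esize x + 3) ^ k.
  apply: leq_trans (vk _) _; apply: leq_expn.
  by rewrite !esize_pair esize_cons; lia.
lia.
Qed.

End Branching.

(** * Folds over lists with bounded intermediate values *)

Section Folding.

Context {X A S : Type} {eX : encodable X} {eA : encodable A}.
Context {eS : encodable S}.

(** The bound [v] on all intermediate states is what excludes exponential growth, for a polynomial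
    step may double the state each time. The loop keeps the unread list on top of the state. *)
Lemma ptime_foldl_closed (l : X -> seq A) (i : X -> S) (step : A * S -> S)
    (v : X -> nat) :
  ptime l -> ptime i -> ptime step -> pbound v ->
  (forall x j, j <= size (l x) ->
     esize (foldl (fun s a => step (a, s)) (i x) (take j (l x))) <= v x) ->
  ptime (fun x => foldl (fun s a => step (a, s)) (i x) (l x)).
Proof.
move=> lP iP [_ sP] vP vx; split.
  by apply: pbound_le vP _ => x; have := vx x _ (leqnn _); rewrite take_size.
have [szl _] := lP; have [_ hP] := ptime_pair lP iP.
move=> Sigma; have [F [u uP FP]] := hP Sigma.
have [G [w [k wk] GP]] := sP Sigma.
pose body := seq_frag (uncons_prog Sigma) (seq_frag (swap_prog _)
               (dip_prog (seq_frag (cons_prog _) G))).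
exists (seq_frag F (seq_frag (uncons_prog _)
         (seq_frag (whilenode_prog body) (drop_prog _)))).
(* Cost of one pass when the list has size at most [L] and the states at most [B]: the first term
   pays for moving trees, the second for [step] on a pair of size at most [L + B]. *)
pose c L B := 100 * L + (L + B + 3) ^ k.
have loop L B r s ts : esize r <= L ->
    (forall j, j <= size r ->
       esize (foldl (fun s a => step (a, s)) s (take j r)) <= B) ->
    tdoes (whilenode_prog body) (enc r :: enc s :: ts)
      (Leaf :: enc (foldl (fun s a => step (a, s)) s r) :: ts)
      (esize r * c L B + 1).
  elim: r s => [|a r IH] s leL leB /=.
    by apply: (@tdoes_le _ _ _ _ 1); [lia | exact: tdoes_whilenode_stop].
  have a_gt0: 0 < esize a by apply: esize_gt0.
  have r_gt0: 0 < esize r by apply: esize_gt0.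
  have aS: esize (a, s) <= L + B.
    move: leL (leB 0 isT); rewrite esize_pair esize_cons /=.
    by lia.
  apply: (@tdoes_le _ _ _ _ (c L B + (esize r * c L B + 1)).+1).
    rewrite esize_cons mulSn mulnDl; move: aS.
    have := leq_pmull (c L B) a_gt0.
    have : 0 < c L B by rewrite /c; move: leL; rewrite esize_cons; lia.
    by lia.
  apply: tdoes_whilenode_step; last first.
    apply: IH => [|j lej]; last exact: leB j.+1 lej.
    by move: leL; rewrite esize_cons; lia.
  apply: (@tdoes_le _ _ _ _ (1 + (((esize a + esize r) * 13 + 20) +
     (esize r * 13 + 10 + (2 + w (a, s)))))).
    have : w (a, s) <= (L + B + 3) ^ k.
      by apply: leq_trans (wk _) _; apply: leq_expn; lia.
    by move: leL; rewrite /c esize_cons; lia.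
  apply: tdoes_seq; first exact: tdoes_uncons.
  apply: tdoes_seq; first exact: tdoes_swap.
  apply: tdoes_dip; apply: tdoes_seq; first exact: tdoes_cons.
  exact: (GP (a, s)).
exists (fun x => u x + (1 + (esize (l x) * c (esize (l x)) (v x) + 1 + 15))).
  by rewrite /c; pbound_tac.
move=> x ts; apply: tdoes_seq; first exact: FP.
apply: tdoes_seq; first exact: tdoes_uncons.
apply: tdoes_seq; last exact: (@tdoes_drop _ Leaf).
by apply: loop => // j; apply: vx.
Qed.

End Folding.

Section Combinators.

Context {X Y Z : Type} {eX : encodable X} {eY : encodable Y}.
Context {eZ : encodable Z}.

Lemma ptime_id : ptime (fun x : X => x).
Proof. exact: ptime_recode. Qed.

Lemma ptime_fst_of (f : X -> Y * Z) : ptime f -> ptime (fun x => (f x).1).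
Proof. by move=> fP; apply: ptime_comp ptime_fst fP. Qed.

Lemma ptime_snd_of (f : X -> Y * Z) : ptime f -> ptime (fun x => (f x).2).
Proof. by move=> fP; apply: ptime_comp ptime_snd fP. Qed.

Lemma ptime_cons (f : X -> Y) (g : X -> seq Y) :
  ptime f -> ptime g -> ptime (fun x => f x :: g x).
Proof.
move=> fP gP.
apply: (ptime_comp (g := fun p => p.1 :: p.2) _ (ptime_pair fP gP)).
exact: ptime_recode.
Qed.

Lemma ptime_comp2 {T : Type} {eT : encodable T} (h : Y -> Z -> T)
    (f : X -> Y) (g : X -> Z) :
  ptime (fun p => h p.1 p.2) -> ptime f -> ptime g ->
  ptime (fun x => h (f x) (g x)).
Proof. by move=> hP fP gP; apply: (ptime_comp hP (ptime_pair fP gP)). Qed.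

End Combinators.

Section EnvironmentFolding.

Context {X A S : Type} {eX : encodable X} {eA : encodable A}.
Context {eS : encodable S}.

(** The environment [x] travels inside the state of a closed fold. *)
Lemma ptime_foldl (l : X -> seq A) (i : X -> S) (step : X -> A -> S -> S)
    (v : X -> nat) :
  ptime l -> ptime i ->
  ptime (fun p : X * (A * S) => step p.1 p.2.1 p.2.2) -> pbound v ->
  (forall x j, j <= size (l x) ->
     esize (foldl (fun s a => step x a s) (i x) (take j (l x))) <= v x) ->
  ptime (fun x => foldl (fun s a => step x a s) (i x) (l x)).
Proof.
move=> lP iP sP vP vx.
pose step' (p : A * (X * S)) := (p.2.1, step p.2.1 p.1 p.2.2).
have foldE x s r : foldl (fun s a => step' (a, s)) (x, s) r =
    (x, foldl (fun s a => step x a s) s r).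
  by elim: r s => //= a r IH s; rewrite IH.
have stepP: ptime step'.
  apply: ptime_pair; first exact/ptime_fst_of/ptime_snd.
  apply: (ptime_comp (f := fun p : A * (X * S) => (p.2.1, (p.1, p.2.2))) sP).
  apply: ptime_pair; first exact/ptime_fst_of/ptime_snd.
  by apply: ptime_pair; [exact: ptime_fst | exact/ptime_snd_of/ptime_snd].
have foldP: ptime (fun x => foldl (fun s a => step' (a, s)) (x, i x) (l x)).
  apply: (@ptime_foldl_closed _ _ _ _ _ _ l (fun x => (x, i x)) step'
    (fun x => esize x + v x + 1)) => // [||x j lej].
  - by apply: ptime_pair => //; apply: ptime_id.
  - by pbound_tac.
  by rewrite foldE esize_pair; have := vx x j lej; lia.
by apply: ptime_ext (ptime_snd_of foldP) => x; rewrite foldE.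
Qed.

End EnvironmentFolding.

(** A hook for [ptime_tac], redefined once the list operations are available. *)
Ltac ptime_step := fail.

Ltac ptime_tac := repeat first
  [ assumption | exact: ptime_id | exact: ptime_const
  | apply: ptime_pair | ptime_step | apply: ptime_cons | apply: ptime_if
  | apply: ptime_fst_of | apply: ptime_snd_of ].

(** * List operations expressed as folds *)

Section ListFolds.

Context {X A B S : Type} {eX : encodable X} {eA : encodable A}.
Context {eB : encodable B} {eS : encodable S}.

Lemma ptime_match (l : X -> seq A) (f : X -> B) (g : X -> A -> seq A -> B) :
  ptime l -> ptime f ->
  ptime (fun p : X * (A * seq A) => g p.1 p.2.1 p.2.2) ->
  ptime (fun x => if l x is y :: s then g x y s else f x).
Proof.
move=> lP fP gP.
apply: (ptime_case (g := fun p => g p.2 p.1.1 p.1.2) lP fP).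
apply: (ptime_comp (f := fun p : (A * seq A) * X => (p.2, p.1)) gP).
by ptime_tac.
Qed.

Lemma ptime_succ (n : X -> nat) : ptime n -> ptime (fun x => (n x).+1).
Proof.
move=> nP; apply: (ptime_comp (g := fun p : unit * nat => p.2.+1)
  (f := fun x => (tt, n x))).
  by apply: ptime_recode => -[[] m].
by ptime_tac.
Qed.

Lemma ptime_unary (n : X -> nat) : ptime n -> ptime (fun x => nseq (n x) tt).
Proof.
by move=> nP; apply: (ptime_comp (g := fun n => nseq n tt)) nP;
  apply: ptime_recode.
Qed.

Lemma ptime_of_unary (s : X -> seq unit) :
  ptime s -> ptime (fun x => size (s x)).
Proof.
move=> sP; apply: (ptime_comp (g := size)) sP; apply: ptime_recode => r.
by rewrite /enc /enc_nat; congr enc; elim: r => //= -[] u ->.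
Qed.

Lemma esize_rev (s : seq A) : esize (rev s) = esize s.
Proof.
elim: s => // a s IH; rewrite rev_cons -cats1.
have := @esize_cat _ eA (rev s) [:: a].
by rewrite !esize_cons esize_nil IH; lia.
Qed.

Lemma esize_take j (s : seq A) : esize (take j s) <= esize s.
Proof.
have := @esize_cat _ eA (take j s) (drop j s); rewrite cat_take_drop.
by have := @esize_gt0 _ (enc_seq (eX := eA)) (drop j s); lia.
Qed.

Lemma esize_drop j (s : seq A) : esize (drop j s) <= esize s.
Proof.
have := @esize_cat _ eA (take j s) (drop j s); rewrite cat_take_drop.
by have := @esize_gt0 _ (enc_seq (eX := eA)) (take j s); lia.
Qed.

Lemma ptime_rev (l : X -> seq A) : ptime l -> ptime (fun x => rev (l x)).
Proof.
move=> lP.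
have revE (s r : seq A) : foldl (fun s a => a :: s) r s = catrev s r.
  by elim: s r => //= a s IH r; rewrite IH.
apply: (ptime_ext (f := fun x => foldl (fun s a => a :: s) [::] (l x))).
  by move=> x; rewrite revE.
apply: (ptime_foldl (v := fun x => esize (l x))) => //; try by ptime_tac.
  by case: lP.
by move=> x j _; rewrite revE -/(rev _) esize_rev esize_take.
Qed.

Lemma ptime_foldr (l : X -> seq A) (i : X -> S) (step : X -> A -> S -> S)
    (v : X -> nat) :
  ptime l -> ptime i ->
  ptime (fun p : X * (A * S) => step p.1 p.2.1 p.2.2) -> pbound v ->
  (forall x j, esize (foldr (step x) (i x) (drop j (l x))) <= v x) ->
  ptime (fun x => foldr (step x) (i x) (l x)).
Proof.
move=> lP iP sP vP vx.
apply: (ptime_ext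
  (f := fun x => foldl (fun s a => step x a s) (i x) (rev (l x)))).
  by move=> x; rewrite foldl_rev.
apply: ptime_foldl (ptime_rev lP) iP sP vP _ => x j; rewrite size_rev => lej.
by rewrite take_rev foldl_rev vx.
Qed.

End ListFolds.

Section ListFunctions.

Context {X A B S : Type} {eX : encodable X} {eA : encodable A}.
Context {eB : encodable B} {eS : encodable S}.

Lemma ptime_cat (l r : X -> seq A) :
  ptime l -> ptime r -> ptime (fun x => l x ++ r x).
Proof.
move=> lP rP.
have catE (s t : seq A) : foldr cons t s = s ++ t by elim: s => //= a s ->.
apply: (ptime_ext (f := fun x => foldr cons (r x) (l x))) => [x|].
  exact: catE.
apply: (ptime_foldr (step := fun _ => cons)
  (v := fun x => esize (l x) + esize (r x))) => //;
  try by ptime_tac.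
  by case: lP rP => + _ [+ _]; apply: pbound_add.
move=> x j; rewrite catE; have := @esize_cat _ eA (drop j (l x)) (r x).
by have := @esize_drop _ eA j (l x); lia.
Qed.

Lemma esize_map_le (f : A -> B) (s : seq A) L M :
  esize s <= L -> (forall a, esize a <= L -> esize (f a) <= M) ->
  esize (map f s) <= size s * M.+1 + 1.
Proof.
move=> sL fM; elim: s sL => //= a s IH; rewrite esize_cons => sL.
rewrite esize_cons.
have ea : esize (f a) <= M by apply: fM; lia.
have := IH (leq_trans _ sL); lia.
Qed.

Lemma ptime_map (l : X -> seq A) (f : X -> A -> B) :
  ptime l -> ptime (fun p : X * A => f p.1 p.2) ->
  ptime (fun x => [seq f x a | a <- l x]).
Proof.
move=> lP fP.
have mapE x s : foldr (fun a r => f x a :: r) [::] s = [seq f x a | a <- s].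
  by [].
have [[k fk] _] := fP; have [szl _] := lP.
apply: (ptime_ext
  (f := fun x => foldr (fun a r => f x a :: r) [::] (l x))) => //.
apply: (ptime_foldr (v := fun x =>
   esize (l x) * ((esize x + esize (l x) + 3) ^ k + 1) + 1)) => //.
- by ptime_tac.
- apply: ptime_cons; last by ptime_tac.
  apply: (ptime_comp (f := fun p : X * (A * seq B) => (p.1, p.2.1)) fP).
  by ptime_tac.
- by pbound_tac.
move=> x j; rewrite mapE.
apply: leq_trans (esize_map_le (esize_drop j (l x))
  (M := (esize x + esize (l x) + 3) ^ k) _) _.
  move=> a aL; apply: leq_trans (fk (x, a)) _; apply: leq_expn.
  by rewrite esize_pair; lia.
rewrite leq_add2r; apply: leq_mul; last by rewrite addn1.
by have := @size_le_esize _ eA (l x); rewrite size_drop; lia.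
Qed.

Lemma ptime_filter (l : X -> seq A) (b : X -> A -> bool) :
  ptime l -> ptime (fun p : X * A => b p.1 p.2) ->
  ptime (fun x => [seq a <- l x | b x a]).
Proof.
move=> lP bP.
apply: (ptime_ext (f := fun x =>
  foldr (fun a r => if b x a then a :: r else r) [::] (l x))) => [x|].
  by elim: (l x) => //= a s ->.
apply: (ptime_foldr (v := fun x => esize (l x))) => //; try by ptime_tac.
- apply: ptime_if; try by ptime_tac.
  apply: (ptime_comp (f := fun p : X * (A * seq A) => (p.1, p.2.1)) bP).
  by ptime_tac.
- by case: lP.
move=> x j; apply: leq_trans (esize_drop j _).
elim: (drop j (l x)) => //= a s IH; rewrite esize_cons.
by case: ifP => _; rewrite ?esize_cons; lia.
Qed.

Lemma ptime_all (l : X -> seq A) (b : X -> A -> bool) :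
  ptime l -> ptime (fun p : X * A => b p.1 p.2) ->
  ptime (fun x => all (b x) (l x)).
Proof.
move=> lP bP.
apply: (ptime_ext (f := fun x =>
  foldr (fun a r => if b x a then r else false) true (l x))) => [x|].
  by elim: (l x) => //= a s ->; case: (b x a).
apply: (ptime_foldr (v := fun x => 3)) => //; try by ptime_tac.
- apply: ptime_if; try by ptime_tac.
  apply: (ptime_comp (f := fun p : X * (A * bool) => (p.1, p.2.1)) bP).
  by ptime_tac.
- exact: pbound_const.
by move=> x j; apply: esize_bool.
Qed.

End ListFunctions.

Section Iteration.

Context {X A B S : Type} {eX : encodable X} {eA : encodable A}.
Context {eB : encodable B} {eS : encodable S}.

Lemma ptime_size (l : X -> seq A) : ptime l -> ptime (fun x => size (l x)).
Proof.
move=> lP; apply: (ptime_ext (f := fun x => size [seq tt | a <- l x])) => [x|].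
  exact: size_map.
by apply/ptime_of_unary/ptime_map => //; ptime_tac.
Qed.

Lemma ptime_iter (n : X -> nat) (i : X -> S) (f : X -> S -> S) (v : X -> nat) :
  ptime n -> ptime i -> ptime (fun p : X * S => f p.1 p.2) -> pbound v ->
  (forall x j, j <= n x -> esize (iter j (f x) (i x)) <= v x) ->
  ptime (fun x => iter (n x) (f x) (i x)).
Proof.
move=> nP iP fP vP vx.
have iterE x m :
    foldl (fun s _ => f x s) (i x) (nseq m tt) = iter m (f x) (i x).
  by elim: m (i x) => // m IH s; rewrite iterSr -IH.
apply: (ptime_ext
  (f := fun x => foldl (fun s _ => f x s) (i x) (nseq (n x) tt))).
  by move=> x; rewrite iterE.
apply: (ptime_foldl (v := v)) => //.
- exact: ptime_unary.
- apply: (ptime_comp (f := fun p : X * (unit * S) => (p.1, p.2.2)) fP).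
  by ptime_tac.
move=> x j; rewrite size_nseq => lej.
have -> : take j (nseq (n x) tt) = nseq j tt by rewrite take_nseq.
by rewrite iterE vx.
Qed.

End Iteration.

Section Drop.

Context {X A B S : Type} {eX : encodable X} {eA : encodable A}.
Context {eB : encodable B} {eS : encodable S}.

Lemma ptime_drop (n : X -> nat) (l : X -> seq A) :
  ptime n -> ptime l -> ptime (fun x => drop (n x) (l x)).
Proof.
move=> nP lP.
have iterE m (s : seq A) : iter m behead s = drop m s.
  by elim: m s => [|m IH] s; rewrite ?drop0 // iterSr IH; case: s => //= a s.
apply: (ptime_ext (f := fun x => iter (n x) behead (l x))) => [x|].
  exact: iterE.
apply: (ptime_iter (v := fun x => esize (l x))) => //; last first.
- by move=> x j _; rewrite iterE esize_drop.
- by case: lP.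
apply: (ptime_ext
  (f := fun p : X * seq A => if p.2 is _ :: s then s else [::])).
  by case=> x [].
by apply: ptime_match; ptime_tac.
Qed.

End Drop.

Section ListAccess.

Context {X A B S : Type} {eX : encodable X} {eA : encodable A}.
Context {eB : encodable B} {eS : encodable S}.

Lemma ptime_nth (d : X -> A) (n : X -> nat) (l : X -> seq A) :
  ptime d -> ptime n -> ptime l -> ptime (fun x => nth (d x) (l x) (n x)).
Proof.
move=> dP nP lP.
apply: (ptime_ext
  (f := fun x => if drop (n x) (l x) is a :: s then a else d x)).
  by move=> x; rewrite -[n x in RHS]addn0 -nth_drop; case: (drop _ _).
by apply: ptime_match => //; [exact: ptime_drop | ptime_tac].
Qed.

Lemma ptime_iota (n : X -> nat) : ptime n -> ptime (fun x => iota 0 (n x)).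
Proof.
move=> nP.
have iterE m : rev (iter m (fun s => size s :: s) [::]) = iota 0 m.
  elim: m => // m IH; rewrite iterS rev_cons IH -cats1 -addn1 iotaD /=.
  by congr (_ ++ [:: _]); rewrite -size_rev IH size_iota.
apply: (ptime_ext (f := fun x => rev (iter (n x) (fun s => size s :: s) [::]))).
  by move=> x; apply: iterE.
apply: ptime_rev; apply: (ptime_iter (v := fun x =>
   esize (n x) * (esize (n x) + 1) + 1)) => //.
- by ptime_tac.
- apply: ptime_cons; last by ptime_tac.
  by apply: ptime_size; ptime_tac.
- by case: nP => nb _; pbound_tac.
move=> x j lej; rewrite -esize_rev iterE.
apply: leq_trans (esize_seq_le (m := j) (B := esize (n x)) _ _) _.
- by rewrite size_iota.
- move=> k; rewrite size_iota => ltk k0; rewrite nth_iota // add0n.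
  by rewrite !esize_nat; lia.
rewrite leq_add2r; apply: leq_mul; last by rewrite addn1.
by rewrite esize_nat; lia.
Qed.

Lemma ptime_flatten (l : X -> seq (seq A)) :
  ptime l -> ptime (fun x => flatten (l x)).
Proof.
move=> lP; apply: (ptime_foldr (v := fun x => esize (l x))) => //.
- by ptime_tac.
- by apply: ptime_cat; ptime_tac.
- by case: lP.
move=> x j; apply: leq_trans (esize_drop j _).
elim: (drop j (l x)) => //= s r IH; rewrite esize_cons.
by have := @esize_cat _ eA s (flatten r); rewrite /flatten /= in IH *; lia.
Qed.

Lemma ptime_negb (b : X -> bool) : ptime b -> ptime (fun x => ~~ b x).
Proof.
move=> bP; apply: (ptime_ext (f := fun x => if b x then false else true)).
  by move=> x; case: (b x).
by ptime_tac.
Qed.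

Lemma ptime_andb (b c : X -> bool) :
  ptime b -> ptime c -> ptime (fun x => b x && c x).
Proof.
move=> bP cP; apply: (ptime_ext (f := fun x => if b x then c x else false)).
  by move=> x; case: (b x).
by ptime_tac.
Qed.

Lemma ptime_orb (b c : X -> bool) :
  ptime b -> ptime c -> ptime (fun x => b x || c x).
Proof.
move=> bP cP; apply: (ptime_ext (f := fun x => if b x then true else c x)).
  by move=> x; case: (b x).
by ptime_tac.
Qed.

End ListAccess.

Section Equality.

Context {X : Type} {eX : encodable X}.

Lemma ptime_eq_bool (b c : X -> bool) :
  ptime b -> ptime c -> ptime (fun x => b x == c x).
Proof.
move=> bP cP.
apply: (ptime_ext (f := fun x => if b x then c x else ~~ c x)).
  by move=> x; case: (b x); case: (c x).
by apply: ptime_if => //; apply: ptime_negb.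
Qed.

Lemma ptime_eq_unit (b c : X -> unit) : ptime (fun x => b x == c x).
Proof.
apply: (ptime_ext (f := fun=> true)); last exact: ptime_const.
by move=> x; case: (b x); case: (c x).
Qed.

Lemma ptime_eq_letter (b c : X -> letter) :
  ptime b -> ptime c -> ptime (fun x => b x == c x).
Proof.
pose bits (l : letter) :=
  match l with inl x => (false, x) | inr x => (true, x) end.
move=> bP cP.
have bitsP (f : X -> letter) : ptime f -> ptime (fun x => bits (f x)).
  by apply: ptime_comp; apply: ptime_recode => -[].
apply: (ptime_ext (f := fun x => ((bits (b x)).1 == (bits (c x)).1) &&
    ((bits (b x)).2 == (bits (c x)).2))).
  by move=> x; case: (b x) => y; case: (c x).
by apply: ptime_andb; apply: ptime_eq_bool; ptime_tac; apply: bitsP.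
Qed.

End Equality.

Section SeqEquality.

Context {X : Type} {eX : encodable X}.

(** One pass over [s] keeps the unread part of [t] in its state. If [t] ends too early the flag
    becomes false; if part of [t] is left over, the answer is false as well. *)
Lemma ptime_eq_seq {A : eqType} {eA : encodable A} (s t : X -> seq A) :
  ptime (fun p : A * A => p.1 == p.2) ->
  ptime s -> ptime t -> ptime (fun x => s x == t x).
Proof.
move=> eqaP sP tP.
pose step (a : A) (st : bool * seq A) :=
  if st.2 is b :: r then (st.1 && (a == b), r) else (false, [::]).
have stepE u b r : foldl (fun st a => step a st) (b, r) u =
    (b && (u == take (size u) r), drop (size u) r).
  elim: u b r => [|a u IH] b [|c r] //=; rewrite ?andbT // IH ?andbF //.
  by rewrite eqseq_cons andbA.
apply: (ptime_ext (f := fun x =>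
  let st := foldl (fun st a => step a st) (true, t x) (s x) in
  if st.2 is _ :: _ then false else st.1)) => [x|] /=.
  rewrite stepE /=; case dE: (drop _ _) => [|c r].
    by rewrite -[t x in RHS](cat_take_drop (size (s x))) dE cats0.
  by apply/esym/eqP => stE; move: dE; rewrite stE drop_size.
have foldP: ptime (fun x => foldl (fun st a => step a st) (true, t x) (s x)).
  apply: (ptime_foldl (v := fun x => esize (t x) + 4)
    (step := fun _ a st => step a st)) => //.
  - by ptime_tac.
  - apply: ptime_match; try by ptime_tac.
    apply: ptime_pair; last by ptime_tac.
    apply: ptime_andb; first by ptime_tac.
    by apply: (ptime_comp2 (h := fun a b => a == b)); ptime_tac.
  - by case: tP => tb _; pbound_tac.
  move=> x j _; rewrite stepE esize_pair.
  by have := @esize_drop _ eA (size (take j (s x))) (t x);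
    have := esize_bool
      (true && (take j (s x) == take (size (take j (s x))) (t x))); lia.
by apply: ptime_match; ptime_tac.
Qed.

Lemma ptime_eq_nat (m n : X -> nat) :
  ptime m -> ptime n -> ptime (fun x => m x == n x).
Proof.
move=> mP nP; apply: (ptime_ext (f := fun x => nseq (m x) tt == nseq (n x) tt)).
  move=> x; apply/eqP/eqP => [|->] // /(congr1 size).
  by rewrite !size_nseq.
by apply: ptime_eq_seq; [exact: ptime_eq_unit| exact: ptime_unary..].
Qed.

Lemma ptime_index {A : eqType} {eA : encodable A} (a : X -> A)
    (s : X -> seq A) :
  ptime (fun p : A * A => p.1 == p.2) ->
  ptime a -> ptime s -> ptime (fun x => index (a x) (s x)).
Proof.
move=> eqaP aP sP.
have indexE b t : foldr (fun c n => if c == b then 0 else n.+1) 0 t = index b t.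
  by elim: t => //= c t ->.
apply: (ptime_ext (f := fun x =>
  foldr (fun c n => if c == a x then 0 else n.+1) 0 (s x))) => [x|].
  exact: indexE.
apply: (ptime_foldr (v := fun x => esize (s x) * 2)) => //.
- by ptime_tac.
- apply: ptime_if; try by ptime_tac.
    apply: (ptime_comp2 (h := fun a b => a == b)) => //; first by ptime_tac.
    by apply: (ptime_comp aP); ptime_tac.
  by apply: ptime_succ; ptime_tac.
- by case: sP => sb _; pbound_tac.
move=> x j; rewrite indexE esize_nat.
have := index_size (a x) (drop j (s x)).
have := @size_le_esize _ eA (drop j (s x)).
by have := @esize_drop _ eA j (s x); lia.
Qed.

End SeqEquality.

Lemma ptime_comp3 {X Y Z T R : Type} {eX : encodable X} {eY : encodable Y}
    {eZ : encodable Z} {eT : encodable T} {eR : encodable R}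
    (h : Y -> Z -> T -> R) (f : X -> Y) (g : X -> Z) (k : X -> T) :
  ptime (fun p => h p.1 p.2.1 p.2.2) -> ptime f -> ptime g -> ptime k ->
  ptime (fun x => h (f x) (g x) (k x)).
Proof.
move=> hP fP gP kP.
exact: (ptime_comp hP (ptime_pair fP (ptime_pair gP kP))).
Qed.

Lemma ptime_eq_seq_nat {X : Type} {eX : encodable X} (s t : X -> seq nat) :
  ptime s -> ptime t -> ptime (fun x => s x == t x).
Proof.
by apply: ptime_eq_seq; apply: ptime_eq_nat; ptime_tac.
Qed.

Lemma ptime_index_nat {X : Type} {eX : encodable X} (a : X -> nat)
    (s : X -> seq nat) :
  ptime a -> ptime s -> ptime (fun x => index (a x) (s x)).
Proof.
by apply: ptime_index; apply: ptime_eq_nat; ptime_tac.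
Qed.

Lemma ptime_eq_word {X : Type} {eX : encodable X} (s t : X -> seq letter) :
  ptime s -> ptime t -> ptime (fun x => s x == t x).
Proof.
by apply: ptime_eq_seq; apply: ptime_eq_letter; ptime_tac.
Qed.

Lemma ptime_index_word {X : Type} {eX : encodable X} (a : X -> seq letter)
    (s : X -> seq (seq letter)) :
  ptime a -> ptime s -> ptime (fun x => index (a x) (s x)).
Proof.
by apply: ptime_index; apply: ptime_eq_word; ptime_tac.
Qed.

Lemma ptime_last {X A : Type} {eX : encodable X} {eA : encodable A}
    (d : X -> A) (s : X -> seq A) :
  ptime d -> ptime s -> ptime (fun x => last (d x) (s x)).
Proof.
move=> dP sP.
apply: (ptime_ext (f := fun x => if rev (s x) is a :: r then a else d x)).
  by move=> x; case/lastP: (s x) => // t a; rewrite rev_rcons last_rcons.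
by apply: ptime_match; [apply: ptime_rev | | ptime_tac].
Qed.

Lemma ptime_behead {X A : Type} {eX : encodable X} {eA : encodable A}
    (s : X -> seq A) : ptime s -> ptime (fun x => behead (s x)).
Proof.
move=> sP; apply: (ptime_ext (f := fun x => if s x is a :: r then r else [::])).
  by move=> x; case: (s x).
by apply: ptime_match; ptime_tac.
Qed.

Lemma ptime_head {X A : Type} {eX : encodable X} {eA : encodable A}
    (d : X -> A) (s : X -> seq A) :
  ptime d -> ptime s -> ptime (fun x => head (d x) (s x)).
Proof.
move=> dP sP.
apply: (ptime_ext (f := fun x => if s x is a :: r then a else d x)).
  by move=> x; case: (s x).
by apply: ptime_match; ptime_tac.
Qed.

Ltac ptime_step ::= cbv beta; first
  [ apply: ptime_succ | apply: ptime_cat | apply: ptime_map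
  | apply: ptime_filter | apply: ptime_all | apply: ptime_size
  | apply: ptime_nth | apply: ptime_iota | apply: ptime_flatten
  | apply: ptime_eq_letter | apply: ptime_eq_nat
  | apply: ptime_eq_seq_nat | apply: ptime_index_nat
  | apply: ptime_eq_word | apply: ptime_index_word
  | apply: ptime_negb | apply: ptime_andb | apply: ptime_orb
  | apply: ptime_match ].

(** * From polynomial-time functions on words to the class P *)

Section Decision.

Variable Sigma : finType.
Context {eSigma : encodable Sigma}.

Local Notation symbol := (Sigma + option bool)%type.
Local Notation prog := (fragment 3 symbol).
Local Notation "# k" := (@tape_at k isT) (at level 8).

Fixpoint push_word (w : seq symbol) : prog :=
  if w is x :: w' then seq_frag (push_word w') (push_frag #0 x)
  else skip_prog _.

Lemma does_push_word w m s1 s2 s3 :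
  does (push_word w) (stacks m s1 s2 s3) (stacks (w ++ m) s1 s2 s3)
    (2 * size w + 1).
Proof.
elim: w => [|x w IH]; first exact: does_skip.
apply: (@does_le _ _ _ _ _ ((2 * size w + 1) + 2)); first by rewrite /=; lia.
by apply: does_seq IH _; apply: does_push.
Qed.

Definition translate_letter : prog :=
  seq_frag
    (foldr (fun x F => if_frag #1 (top_is (inl x))
       (push_word (node_symbol _ :: serial _ (enc x))) F) (skip_prog _)
       (enum Sigma))
    (pop_frag _ #1).

Definition max_esize : nat := \max_(x : Sigma) esize x.

Lemma does_translate_letter x t v :
  does translate_letter (stacks (serial _ t) (inl x :: v) [::] [::])
    (stacks (serial _ (Node (enc x) t)) v [::] [::])
    (#|Sigma| + 2 * max_esize + 4).
Proof.
apply: (@does_le _ _ _ _ _ (#|Sigma| + (2 * max_esize + 3) + 1)); first lia.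
apply: (@does_seq _ _ _ _ _
  (stacks (serial _ (Node (enc x) t)) (inl x :: v) [::] [::]));
  last exact: does_pop.
have: x \in enum Sigma by rewrite mem_enum.
rewrite cardE; elim: (enum Sigma) => //= y r IH xr.
rewrite addSn; apply: does_if; rewrite /top_is /=.
rewrite -[Some _ == _]/(x == y); move: xr; rewrite inE.
case: eqP => [<- _|_ /= /IH //].
have le_x : esize x <= max_esize by apply: leq_bigmax.
apply: (@does_le _ _ _ _ _ (2 * (esize x).+1 + 1)); first lia.
rewrite /esize -(size_serial Sigma).
exact: (does_push_word (node_symbol Sigma :: serial Sigma (enc x))).
Qed.

(** The tree of a list grows by adding cells in front, so it has to be built from the last letter;
    the first loop reverses the word to bring that letter to the top. *)
Definition load_prog : prog :=
  seq_frag
    (while_frag #0 isSome (seq_frag (copy_frag _ #0 #1) (pop_frag _ #0)))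
    (seq_frag (leaf_prog _)
       (while_frag #1 isSome translate_letter)).

Lemma does_load (w : seq Sigma) :
  does load_prog (stacks (map inl w) [::] [::] [::])
    (stacks (serial _ (enc w)) [::] [::] [::])
    ((4 * size w + 1) + (2 + (size w * (#|Sigma| + 2 * max_esize + 5) + 1))).
Proof.
apply: (@does_seq _ _ _ _ _ (stacks [::] (map inl (rev w)) [::] [::])).
  suff gen r :
    does (while_frag #0 isSome
        (seq_frag (copy_frag _ #0 #1) (pop_frag _ #0)))
      (stacks (map inl w) (map inl r) [::] [::])
      (stacks [::] (map inl (catrev w r)) [::] [::]) (4 * size w + 1).
    exact: (gen [::]).
  elim: w r => [|x w IH] r.
    exact: does_while_stop.
  apply: (@does_le _ _ _ _ _ (3 + (4 * size w + 1)).+1).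
    by rewrite /=; lia.
  apply: (@does_while_step _ _ _ _ _ _
    (stacks (map inl w) (map inl (x :: r)) [::] [::])) => //.
  apply: (@does_seq _ _ _ _ _
    (stacks (map inl (x :: w)) (map inl (x :: r)) [::] [::]) _ 2 1).
    exact: does_copy.
  exact: does_pop.
apply: does_seq; first exact: does_push.
have -> : enc w = foldl (fun t x => Node (enc x) t) Leaf (rev w).
  by rewrite foldl_rev.
rewrite -size_rev -[set_nth _ _ _ _]/(stacks (serial _ Leaf) (map inl (rev w))
  [::] [::]).
elim: (rev w) Leaf => [|x r IH] t; first exact: does_while_stop.
apply: (@does_le _ _ _ _ _ ((#|Sigma| + 2 * max_esize + 4) +
  (size r * (#|Sigma| + 2 * max_esize + 5) + 1)).+1); first by rewrite /=; lia.
apply: (@does_while_step _ _ _ _ _ _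
  (stacks (serial _ (Node (enc x) t)) (map inl r) [::] [::])) => //.
exact: does_translate_letter.
Qed.

Theorem ptime_in_P (f : seq Sigma -> bool) : ptime f -> in_P (fun w => f w).
Proof.
case=> _ /(_ Sigma)[F [u [k uk] FP]].
(* Of the two Booleans only [true] has a word that starts with a node symbol. *)
exists (fragment_machine (seq_frag load_prog F) (top_is (node_symbol Sigma))).
pose c := #|Sigma| + 2 * max_esize + 9.
(* The power bounds the running time of [F] on the encoded word. The constant [c] is the loading
   cost per letter; 5 is the remaining loading cost of 4 and one step for the verdict. *)
exists (((max_esize.+1)%:P * 'X + 3%:P) ^+ k + (c%:P * 'X + 5%:P))%R => w.
have load : does load_prog [:: map inl w]
    (stacks (serial _ (enc w)) [::] [::] [::]) (c * size w + 4).
  move=> T sT; have [|t [T' [le_t rT sT']]] := @does_load w T.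
    by move=> i; move: (sT i); case: i => -[|[|[|[|]]]].
  by exists t, T'; split=> //; apply: leq_trans le_t _; rewrite /c; lia.
have le_w : esize w <= max_esize.+1 * size w + 1.
  elim: w {load} => [|x w IH]; first by rewrite esize_nil addn1.
  rewrite esize_cons /=.
  have le_x : esize x <= max_esize by apply: leq_bigmax.
  by lia.
have doF : does F (stacks (serial _ (enc w)) [::] [::] [::])
    (stacks (serial _ (enc (f w))) [::] [::] [::]) (u w).
  by have := FP w [::] [::] [::] [::]; rewrite /serials /= !cats0.
have [t le_t vt] := fragment_machine_run (top_is (node_symbol Sigma))
  (does_seq load doF).
exists t, (f w); split=> //; last by rewrite vt; case: (f w).
rewrite hornerD horner_exp !hornerD !hornerM !hornerX !hornerC.
apply: leq_trans le_t _.
apply: (@leq_trans ((max_esize.+1 * size w + 3) ^ k + (c * size w + 5))).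
  have : u w <= (max_esize.+1 * size w + 3) ^ k.
    by apply: leq_trans (uk w) _; apply: leq_expn; lia.
  by lia.
by [].
Qed.

End Decision.

(** * Sifting *)

(* A partial bijection of {1, ..., n} is listed by its values, with 0 for
   undefined; positions start from 0. *)
Definition mulL (f g : seq nat) : seq nat := [seq nth 0 (0 :: g) v | v <- f].

(** [index] returns [size g] for a point that is not a value, and this becomes 0, that is,
    undefined. *)
Definition invL (g : seq nat) : seq nat :=
  [seq (if index j.+1 g == size g then 0 else (index j.+1 g).+1)
     | j <- iota 0 (size g)].

(** A point outside the domain counts as unmoved, so that partial identities are the elements on
    which sifting has nothing left to do. *)
Definition moved (f : seq nat) (b : nat) : bool :=
  (nth 0 f b != 0) && (nth 0 f b != b.+1).

Definition slot (base f : seq nat) : seq nat :=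
  if [seq b <- base | moved f b] is b :: _ then [:: b; nth 0 f b] else [::].

Definition totalL (f : seq nat) : bool := all (fun v => v != 0) f.

Section Sifting.

Variables (E : Type) (mul : E -> E -> E) (inv : E -> E) (key : E -> seq nat).

(** Products are read from left to right: [inv t] sends the image of the moved base point back.
    Without a matching key nothing changes, so surplus iterations are harmless. *)
Definition sift1 (T : seq E) (g : E) : E :=
  if [seq t <- T | key t == key g] is t :: _ then mul g (inv t) else g.

Definition sift (m : nat) (T : seq E) (g : E) : E := iter m (sift1 T) g.

Definition candidates (gens T : seq E) : seq E :=
  gens ++ flatten [seq [seq mul s t | t <- T] | s <- T].

(* Elements already in the table come first, so that no key is ever lost. *)
Definition table_round (m : nat) (keys : seq (seq nat)) (gens T : seq E) :
  seq E :=
  flatten [seq (if [seq r <- T ++ [seq sift m T c | c <- candidates gens T]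
                      | key r == k] is r :: _ then [:: r] else [::])
             | k <- keys].

End Sifting.

(** * Transport of sifting along a map of carriers *)

Section SiftingMorphism.

Variables (E F : Type) (rep : E -> F).
Variables (mulE : E -> E -> E) (invE : E -> E) (keyE : E -> seq nat).
Variables (mulF : F -> F -> F) (invF : F -> F) (keyF : F -> seq nat).
Hypothesis rep_mul : {morph rep : x y / mulE x y >-> mulF x y}.
Hypothesis rep_inv : {morph rep : x / invE x >-> invF x}.
Hypothesis rep_key : forall x, keyF (rep x) = keyE x.

Lemma filter_rep k T :
  [seq t <- map rep T | keyF t == k] = map rep [seq t <- T | keyE t == k].
Proof.
by rewrite filter_map; congr map; apply: eq_filter => t /=; rewrite rep_key.
Qed.

Lemma sift_rep m T g :
  sift mulF invF keyF m (map rep T) (rep g) = rep (sift mulE invE keyE m T g).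
Proof.
elim: m => //= m IH; rewrite /sift /= -/(sift _ _ _ _ _ _) IH.
rewrite -/(sift mulE invE keyE m T g) /sift1 rep_key filter_rep.
by case: filter => //= t _; rewrite rep_mul rep_inv.
Qed.

Lemma candidates_rep gens T :
  candidates mulF (map rep gens) (map rep T) = map rep (candidates mulE gens T).
Proof.
rewrite /candidates map_cat map_flatten -!map_comp; congr (_ ++ flatten _).
apply: eq_map => s /=; rewrite -!map_comp; apply: eq_map => t /=.
by rewrite rep_mul.
Qed.

Lemma table_round_rep m keys gens T :
  table_round mulF invF keyF m keys (map rep gens) (map rep T) =
  map rep (table_round mulE invE keyE m keys gens T).
Proof.
rewrite /table_round map_flatten -map_comp; congr flatten.
apply: eq_map => k /=.
rewrite candidates_rep -map_comp.
have -> : [seq (sift mulF invF keyF m (map rep T) \o rep) c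
              | c <- candidates mulE gens T] =
    map rep [seq sift mulE invE keyE m T c | c <- candidates mulE gens T].
  by rewrite -map_comp; apply: eq_map => c /=; rewrite sift_rep.
rewrite -map_cat filter_rep.
by case: filter.
Qed.

End SiftingMorphism.

(** * Partial bijections and their lists of values *)

Section PartialBijections.

Variable n : nat.
Implicit Types f g h t u : pbij n.

Local Open Scope group_scope.

Definition rep f : seq nat :=
  [seq (if f i is Some j then (val j).+1 else 0) | i <- enum 'I_n].

Definition is_total f : bool := [forall i, f i != None].

Definition extends g f : Prop := forall i j, f i = Some j -> g i = Some j.

Lemma extendsP g f :
  reflect (extends g f) [forall i, (f i != None) ==> (g i == f i)].
Proof.
apply: (iffP forallP) => gf i => [j fi | ].
  by have := gf i; rewrite fi => /eqP.
by apply/implyP; case fi: (f i) => [j|] // _; rewrite (gf i j).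
Qed.

Lemma size_rep f : size (rep f) = n.
Proof. by rewrite size_map size_enum_ord. Qed.

Lemma nth_rep f (i : 'I_n) :
  nth 0 (rep f) i = if f i is Some j then (val j).+1 else 0.
Proof. by rewrite (nth_map i) ?size_enum_ord // nth_ord_enum. Qed.

Lemma rep_someP f (i j : 'I_n) :
  reflect (f i = Some j) (nth 0 (rep f) i == j.+1).
Proof.
rewrite nth_rep; case: (f i) => [k|]; last by apply: (iffP eqP).
by rewrite eqSS; apply: (iffP eqP) => [/val_inj -> | [->]].
Qed.

Lemma mulE f g i : (f * g) i = obind g (f i).
Proof. by rewrite /mul /= ffunE. Qed.

Lemma oneE i : (1 : pbij n) i = Some i.
Proof. by rewrite /one /= ffunE. Qed.

Lemma invE f i j : (f^-1 i = Some j) <-> (f j = Some i).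
Proof.
by split=> /eqP; [rewrite [f^-1]/(pbij_inv f) pbij_invE | rewrite -pbij_invE];
  move/eqP.
Qed.

Lemma rep_mul : {morph rep : f g / f * g >-> mulL f g}.
Proof.
move=> f g; rewrite /mulL /rep -map_comp; apply: eq_map => i /=.
rewrite mulE; case: (f i) => //= j; exact/esym/nth_rep.
Qed.

Lemma mem_rep f (i j : 'I_n) : f i = Some j -> j.+1 \in rep f.
Proof. by move/rep_someP/eqP <-; rewrite mem_nth // size_rep. Qed.

Lemma rep_inv : {morph rep : f / f^-1 >-> invL f}.
Proof.
move=> f; rewrite /invL size_rep -val_enum_ord -map_comp; apply: eq_map => j /=.
have := index_size j.+1 (rep f); rewrite size_rep leq_eqVlt.
case: eqP => [jN _|_ /= jf].
  case fj: (f^-1 j) => [i|] //; move/invE/mem_rep: fj.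
  by rewrite -index_mem size_rep jN ltnn.
have/rep_someP/invE -> // : nth 0 (rep f) (Ordinal jf) == j.+1.
by rewrite nth_index // -index_mem size_rep.
Qed.

Lemma totalP f : reflect (forall i, exists j, f i = Some j) (is_total f).
Proof.
apply: (iffP forallP) => fT i.
  by have := fT i; case: (f i) => // j; exists j.
by have [j ->] := fT i.
Qed.

Lemma totalL_rep f : totalL (rep f) = is_total f.
Proof.
rewrite /totalL all_map; apply/allP/forallP => fT i.
  by have := fT i; rewrite mem_enum /= => /(_ isT); case: (f i).
by have := fT i; move=> /=; case: (f i).
Qed.

Lemma total_onto f : is_total f -> forall j, exists i, f i = Some j.
Proof.
move/totalP=> fT j; pose F i := odflt i (f i).
have FE i : f i = Some (F i) by have [k fk] := fT i; rewrite /F fk.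
have Finj : injective F.
  by move=> i k Fik; apply: (pbij_inj (FE i)); rewrite FE Fik.
by exists (invF Finj j); rewrite FE f_invF.
Qed.

Lemma total_inv f : is_total f -> is_total f^-1.
Proof.
move=> fT; apply/totalP=> j; have [i fi] := total_onto fT j.
by exists i; apply/invE.
Qed.

Lemma total_one : is_total 1.
Proof. by apply/totalP=> i; exists i; rewrite oneE. Qed.

(** If [f * g] is total then so is [f]; being injective on a finite set, [f] is onto, and therefore
    [g] is defined everywhere too. *)
Lemma total_mulP f g : reflect (is_total f /\ is_total g) (is_total (f * g)).
Proof.
apply: (iffP idP) => [/totalP fgT | [/totalP fT /totalP gT]].
  have fT: is_total f.
    apply/totalP=> i; have [k] := fgT i; rewrite mulE.
    by case: (f i) => // j; exists j.
  split=> //; apply/totalP=> j; have [i fi] := total_onto fT j.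
  by have [k] := fgT i; rewrite mulE fi /=; exists k.
apply/totalP=> i; have [j fj] := fT i; have [k gk] := gT j.
by exists k; rewrite mulE fj.
Qed.

Lemma total_mulV f : is_total f -> f * f^-1 = 1.
Proof.
move/totalP=> fT; apply: pbij_ext => i; rewrite mulE oneE.
by have [j fj] := fT i; rewrite fj /=; apply/invE.
Qed.

Lemma total_mulK f t : is_total t -> f * t^-1 * t = f.
Proof.
move=> tT; have := total_mulV (total_inv tT); rewrite invgK => tV.
by rewrite -mulgA tV mulg1.
Qed.

(** * Levels and keys relative to a base *)

Section Levels.

Variable base : seq nat.
Hypothesis base_uniq : uniq base.
Hypothesis base_mem : base =i iota 0 n.

Local Notation key f := (slot base (rep f)).
Local Notation point j := (nth 0 base j).

Definition level f : nat := find (moved (rep f)) base.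

Lemma slotE f : key f = if level f < size base
  then [:: point (level f); nth 0 (rep f) (point (level f))] else [::].
Proof.
rewrite /slot /level; elim: base => //= b s IH; case: ifP => // _; apply: IH.
Qed.

Lemma level_le f : level f <= size base. Proof. exact: find_size. Qed.

Lemma slot_nil f : key f = [::] <-> level f = size base.
Proof.
rewrite slotE; case: ltngtP (level_le f) => // lt_f _; split=> // E.
by rewrite E ltnn in lt_f.
Qed.

Lemma slot_eq f t : key t = key f -> key f != [::] ->
  [/\ level t = level f, level f < size base &
      nth 0 (rep t) (point (level f)) = nth 0 (rep f) (point (level f))].
Proof.
rewrite !slotE; case: ifP => tl; case: ifP => // fl [] tf E _.
move: tf E => /eqP; rewrite nth_uniq // => /eqP ->; split=> //.
Qed.

Lemma point_lt j : j < size base -> point j < n.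
Proof.
move=> jb; have := base_mem (point j).
by rewrite mem_nth // mem_iota add0n => /esym/andP[].
Qed.

Lemma unmoved_below f j : j < level f -> ~~ moved (rep f) (point j).
Proof. by move=> jf; rewrite (before_find 0 jf). Qed.

Lemma level_ge f k : k <= size base ->
  (forall j, j < k -> ~~ moved (rep f) (point j)) -> k <= level f.
Proof.
move=> kb unm; rewrite leqNgt; apply/negP=> fk.
by have := unm _ fk; rewrite nth_find // has_find (leq_trans fk kb).
Qed.

Lemma moved_level f : level f < size base -> moved (rep f) (point (level f)).
Proof. by move=> fb; apply: nth_find; rewrite has_find. Qed.

Lemma slot_agree f g :
  (forall j, j <= level g -> j < size base ->
     nth 0 (rep f) (point j) = nth 0 (rep g) (point j)) ->
  key f = key g.
Proof.
move=> fg; suff fgl: level f = level g.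
  by rewrite !slotE fgl; case: ifP => // gb; rewrite fg.
rewrite /level in fg *; elim: base fg => //= b s IH fg.
have mE : moved (rep f) b = moved (rep g) b by rewrite /moved (fg 0).
rewrite mE; case: ifP fg => //= _ fg; rewrite IH // => j jg js.
exact: (fg j.+1).
Qed.

Lemma unmoved_total f (i : 'I_n) :
  is_total f -> ~~ moved (rep f) i -> f i = Some i.
Proof.
move=> /totalP fT; rewrite /moved negb_and !negbK => fi.
by apply/rep_someP; move: fi; rewrite nth_rep; have [j ->] := fT i.
Qed.

Lemma slot_nil_sub1 f : key f = [::] -> extends 1 f.
Proof.
move=> /slot_nil fl i j fi; rewrite oneE.
have ib: (i : nat) \in base by rewrite base_mem mem_iota /=.
have := unmoved_below (f := f) (j := index (i : nat) base).
rewrite fl index_mem ib nth_index // => /(_ isT).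
by rewrite /moved nth_rep fi /= eqSS negbK => /eqP/val_inj ->.
Qed.

Lemma slot_nil_one f : is_total f -> key f = [::] -> f = 1.
Proof.
move=> /totalP fT /slot_nil_sub1 f1; apply: pbij_ext => i.
by have [j fj] := fT i; rewrite (f1 _ _ fj).
Qed.

(** Wherever [f] is defined among the base points up to its level, [t] has the same value: at the
    level because the keys agree, before it because [f] fixes the point and so does [t], which is
    total and has the same level. Hence [f * t^-1] fixes these points or is undefined there. *)
Lemma level_sift f t : is_total t -> key t = key f -> key f != [::] ->
  level f < level (f * t^-1).
Proof.
move=> tT tf f0; have [tl fl E] := slot_eq tf f0.
apply: level_ge => // j; rewrite ltnS => jf.
have jb : j < size base by apply: leq_ltn_trans fl.
pose b := Ordinal (point_lt jb); rewrite -[point j]/(val b).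
suff: forall c, f b = Some c -> t b = Some c.
  move=> ft; rewrite /moved nth_rep mulE.
  case fb: (f b) => [c|] //=; move/ft/invE: fb => ->.
  by rewrite eqxx andbF.
move=> c fb; move: jf; rewrite leq_eqVlt => /predU1P[jE|jf].
  apply/rep_someP; rewrite -[nat_of_ord b]/(point j) jE E -jE.
  by rewrite -[point j]/(val b); apply/rep_someP.
have := unmoved_below jf; rewrite -[point j]/(val b) /moved nth_rep fb /= eqSS.
rewrite negbK => cb; have -> : c = b by apply/val_inj/eqP.
apply: unmoved_total tT _.
by apply: unmoved_below; rewrite tl.
Qed.

Lemma level_mul f g k : is_total f -> is_total g ->
  k <= level f -> k <= level g -> k <= level (f * g).
Proof.
move=> fT gT kf kg; have kb := leq_trans kf (level_le f).
apply: level_ge kb _ => j jk.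
have jb : j < size base by apply: leq_trans jk (leq_trans kf (level_le f)).
pose b := Ordinal (point_lt jb); rewrite -[point j]/(val b).
have fb: f b = Some b by apply/(unmoved_total fT)/unmoved_below/(leq_trans jk).
have gb: g b = Some b by apply/(unmoved_total gT)/unmoved_below/(leq_trans jk).
by rewrite /moved nth_rep mulE fb /= gb eqxx andbF.
Qed.

(** All base points up to the level of [t] are fixed by [f], so [f * t] and [t] agree on them. *)
Lemma slot_mul f t : is_total f -> level t < level f -> key (f * t) = key t.
Proof.
move=> fT tf; apply: slot_agree => j jt jb.
pose b := Ordinal (point_lt jb); rewrite -[point j]/(val b).
have fb: f b = Some b.
  by apply/(unmoved_total fT)/unmoved_below/(leq_ltn_trans jt).
by rewrite !nth_rep mulE fb.
Qed.

End Levels.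

End PartialBijections.

(** * Tables and strong generating sets *)

Section StrongGeneratingSets.

Local Open Scope group_scope.

Variables (n : nat) (base : seq nat).
Hypothesis base_uniq : uniq base.
Hypothesis base_mem : base =i iota 0 n.
Implicit Types (f g h s t u : pbij n) (T gens : seq (pbij n)).

Local Notation key := (fun f => slot base (rep f)).
Local Notation lev := (level base).
Local Notation mulgn := (fun f g : pbij n => f * g).
Local Notation invgn := (fun f : pbij n => f^-1).
Local Notation sft := (sift mulgn invgn key).

Definition keys_of T : seq (seq nat) := [seq slot base (rep t) | t <- T].

Lemma sift1P T f :
  (sift1 mulgn invgn key T f = f /\
     slot base (rep f) \notin keys_of T) \/
  (exists t, [/\ t \in T, slot base (rep t) = slot base (rep f) &
     sift1 mulgn invgn key T f = f * t^-1]).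
Proof.
rewrite /sift1; case Tf: [seq _ <- _ | _] => [|t r]; [left; split=> //|right].
  apply/mapP=> -[t tT ft].
  have: t \in [seq t <- T | slot base (rep t) == slot base (rep f)].
    by rewrite mem_filter -ft eqxx.
  by rewrite Tf.
exists t; have: t \in [seq t <- T | slot base (rep t) == slot base (rep f)].
  by rewrite Tf mem_head.
by rewrite mem_filter => /andP[/eqP].
Qed.

(** Counting from the end of the base gives deeper stabilisers smaller indices, which suits the
    recursion in [products]. *)
Definition colevel f := size base - lev f.

Section Table.

Variable T : seq (pbij n).
Hypothesis T_total : {in T, forall t, is_total t}.
Hypothesis T_moved : [::] \notin keys_of T.

(** Every division raises the level, so after [size base] of them no base point is moved. A step
    without division means that the key is absent from the table, and the element no longer
    changes. *)
Lemma sift_key m f :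
  size base <= m -> slot base (rep (sft m T f)) \notin keys_of T.
Proof.
have: slot base (rep (sft m T f)) \notin keys_of T \/ m <= lev (sft m T f).
  elim: m => [|m IH]; first by right.
  rewrite /sift iterS -/(sift _ _ _ m T f).
  case: (sift1P T (sft m T f)) => [[-> k]|[t [tT tk ->]]]; first by left.
  right; have kT: slot base (rep (sft m T f)) \in keys_of T.
    by rewrite -tk; apply: map_f.
  case: IH => [|lm]; first by rewrite kT.
  apply: leq_ltn_trans lm _.
  apply: (level_sift base_uniq base_mem (T_total tT) tk).
  by apply: contraNneq T_moved => <-.
case=> // ml bm; suff -> : slot base (rep (sft m T f)) = [::] by [].
apply/slot_nil/anti_leq; rewrite level_le; exact: leq_trans ml.
Qed.

Definition layer k : {set pbij n} :=
  [set t in 1 :: [seq t <- T | colevel t == k]].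

(* With the table [T] complete, these are the group elements that fix all but
   the last [k] base points. *)
Fixpoint products k : {set pbij n} :=
  if k is k'.+1 then products k' * layer k'.+1 else 1.

Lemma layerP k t :
  reflect (t = 1 \/ t \in T /\ colevel t = k) (t \in layer k).
Proof.
rewrite inE in_cons mem_filter; apply: (iffP orP) => [] [].
- by move/eqP; left.
- by case/andP=> /eqP; right.
- by move->; left.
by case=> tT ->; right; rewrite eqxx.
Qed.

Lemma layer_one k : 1 \in layer k. Proof. by apply/layerP; left. Qed.

Lemma products_one k : 1 \in products k.
Proof.
elim: k => [|k IH] /=; first exact: set11.
by rewrite -(mulg1 1) mem_mulg ?layer_one.
Qed.

Lemma productsS j k : j <= k -> products j \subset products k.
Proof.
elim: k => [|k IH]; first by rewrite leqn0 => /eqP ->.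
rewrite leq_eqVlt => /predU1P[-> //|/IH jk].
by apply: subset_trans jk (mulg_subl _ (layer_one _)).
Qed.

Lemma products_total k f : f \in products k -> is_total f.
Proof.
elim: k f => [|k IH] f /=; first by move/set1P->; apply: total_one.
case/mulsgP=> g t /IH gT /layerP[->|[/T_total tT _]] ->; rewrite ?mulg1 //.
exact/total_mulP.
Qed.

Lemma colevel_products k f : f \in products k -> colevel f <= k.
Proof.
elim: k f => [|k IH] f /=.
  move/set1P->; rewrite leqn0 subn_eq0; apply: level_ge => // j _.
  rewrite /moved; case: (ltnP (nth 0 base j) n) => [jn|jn].
    by rewrite (nth_rep _ (Ordinal jn)) oneE /= eqxx.
  by rewrite nth_default ?size_rep.
case/mulsgP=> g t gP /layerP tP ->.
have gT := products_total gP; have := IH _ gP; case: tP => [->|[tT tk]].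
  by rewrite mulg1; apply: leqW.
rewrite /colevel in tk * => gk.
have : size base - k.+1 <= lev (g * t).
  by apply: (level_mul base_mem gT (T_total tT)); lia.
by lia.
Qed.

(** The last factor different from 1 determines the key, since the deeper factors before it fix the
    base points up to its level. *)
Lemma products_key k f : f \in products k ->
  slot base (rep f) = [::] \/ slot base (rep f) \in keys_of T.
Proof.
elim: k f => [|k IH] f /=.
  move=> f1; left; apply/slot_nil/anti_leq; rewrite level_le.
  by have := @colevel_products 0 f f1; rewrite /colevel leqn0 subn_eq0.
case/mulsgP=> g t gP /layerP tP ->.
case: tP => [->|[tT tk]]; first by rewrite mulg1; apply: IH.
right; rewrite (slot_mul base_mem (products_total gP)); first exact: map_f.
by have := colevel_products gP; rewrite /colevel in tk *; lia.
Qed.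

(** Sifting is undone: [f] is [f * t^-1] times [t], and by the higher level the first factor lies in
    the product of the deeper layers. *)
Lemma sift_products m f k : is_total f -> colevel f <= k ->
  slot base (rep (sft m T f)) = [::] -> f \in products k.
Proof.
move=> fT fk.
have nil_one g : is_total g -> slot base (rep g) = [::] -> g \in products k.
  by move=> gT /(slot_nil_one base_mem gT) ->; apply: products_one.
elim: m f k fT fk nil_one => [|m IH] f k fT fk nil_one; first exact: nil_one.
rewrite /sift iterSr -/(sift _ _ _ m T _).
case: (sift1P T f) => [[-> _]|[t [tT tk ->]]]; first exact: IH.
have t0: slot base (rep f) != [::].
  by apply: contraNneq T_moved => <-; rewrite -tk; apply: map_f.
have [tl fl _] := slot_eq base_uniq tk t0.
have := level_sift base_uniq base_mem (T_total tT) tk t0 => fV.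
have fT': is_total (f * t^-1).
  by apply/total_mulP; split=> //; apply/total_inv/T_total.
case: k fk nil_one => [|k] fk nil_one; first by rewrite /colevel in fk; lia.
move=> sk; have: f * t^-1 \in products (colevel f).-1.
  apply: IH => //; first by rewrite /colevel; lia.
  by move=> g gT /(slot_nil_one base_mem gT) ->; apply: products_one.
move=> fP; apply: (subsetP (productsS fk)).
rewrite -{1}(total_mulK f (T_total tT)).
have -> : colevel f = (colevel f).-1.+1 by rewrite /colevel; lia.
apply: mem_mulg => //; apply/layerP; right; split=> //.
by rewrite /colevel tl; lia.
Qed.

Hypothesis T_closed : {in T &, forall s t,
  slot base (rep (sft (size base) T (s * t))) = [::]}.

Lemma table_mul k s t :
  s \in T -> t \in T -> colevel s <= k -> colevel t <= k ->
  s * t \in products k.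
Proof.
move=> sT tT sk tk.
apply: (sift_products (m := size base)); last exact: T_closed.
  by apply/total_mulP; split; apply: T_total.
rewrite /colevel in sk tk *; have : size base - k <= lev (s * t).
  by apply: (level_mul base_mem (T_total sT) (T_total tT)); lia.
by lia.
Qed.

Lemma layer_mul j k : j <= k -> layer k * layer j \subset products k.
Proof.
have layerS i : i <= k -> layer i \subset products k.
  move=> ik; apply: subset_trans (productsS ik).
  case: i ik => [|i] ik /=; last exact: mulg_subr (products_one i).
  apply/subsetP=> t /layerP[->|[tT t0]]; first exact: set11.
  move: T_moved; have -> // : [::] \in keys_of T.
  have <- : slot base (rep t) = [::]; last exact: map_f.
  apply/slot_nil/anti_leq.
  by rewrite level_le -subn_eq0 -[_ - _]/(colevel t) t0.
move=> jk; apply/subsetP=> x /mulsgP[s t sk tj ->].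
case/layerP: (sk) => [->|[sT sl]].
  by rewrite mul1g; apply: subsetP tj; apply: layerS.
case/layerP: (tj) => [->|[tT tl]].
  by rewrite mulg1; apply: subsetP sk; apply: layerS.
by apply: table_mul => //; rewrite ?sl ?tl.
Qed.

(* Moving a layer past the products of deeper layers uses only that products
   of two table elements sift to 1. *)
Lemma products_mul k : products k * products k \subset products k.
Proof.
elim: k => [|k IH] /=; first by rewrite mulg1.
set P := products k; set C := layer k.+1.
have CP j : j <= k -> C * products j \subset P * C.
  elim: j => [|j IHj] jk /=.
    by rewrite mulg1; apply/mulg_subr/products_one.
  rewrite mulgA; apply: subset_trans (mulSg _ (IHj (ltnW jk))) _.
  rewrite -mulgA; apply: subset_trans (mulgS _ (layer_mul (leqW jk))) _.
  by rewrite /= mulgA mulSg.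
(* The chain of inclusions is [P C P C] in [P P C C], in [P C C], in [P P C], in [P C]. *)
rewrite -mulgA (mulgA C).
apply: subset_trans (mulgS _ (mulSg _ (CP k (leqnn k)))) _.
rewrite -(mulgA P C C) (mulgA P P); apply: subset_trans (mulSg _ IH) _.
apply: subset_trans (mulgS _ (layer_mul (leqnn k.+1))) _.
by rewrite /= mulgA mulSg.
Qed.

End Table.

(** * Completing the table in rounds *)

Section Rounds.

Variables (keys : seq (seq nat)) (gens : seq (pbij n)) (U : {set pbij n}).
Hypothesis keys_uniq : uniq keys.
Hypothesis keys_nil : [::] \notin keys.
Hypothesis keys_slot : forall f, is_total f ->
  slot base (rep f) = [::] \/ slot base (rep f) \in keys.
Hypothesis U_total : {in U, forall u, is_total u}.
Hypothesis U_one : 1 \in U.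
Hypothesis U_mul : {in U &, forall u v, u * v \in U}.
Hypothesis U_inv : {in U, forall u, u^-1 \in U}.
Hypothesis U_gens : {subset gens <= U}.
Hypothesis U_generated : forall W : {set pbij n},
  1 \in W -> {subset gens <= W} -> W * W \subset W -> U \subset W.

Local Notation rnd := (table_round mulgn invgn key (size base) keys gens).

Definition residues T : seq (pbij n) :=
  [seq sft (size base) T c | c <- candidates mulgn gens T].

Lemma round_keys T :
  keys_of (rnd T) = [seq k <- keys | k \in keys_of (T ++ residues T)].
Proof.
rewrite /keys_of /table_round -/(residues T) map_flatten -map_comp.
elim: keys => //= k ks ->.
case E: [seq r <- _ | _] => [|r rs] /=.
  case: ifP => // /mapP[r rT rk].
  have: r \in [seq r <- T ++ residues T | slot base (rep r) == k].
    by rewrite mem_filter -rk eqxx.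
  by rewrite E.
have: r \in [seq r <- T ++ residues T | slot base (rep r) == k].
  by rewrite E mem_head.
rewrite mem_filter => /andP[/eqP <- rT].
by rewrite (map_f (fun t => slot base (rep t)) rT).
Qed.

Lemma round_subset T : {subset rnd T <= T ++ residues T}.
Proof.
move=> r /flattenP[s /mapP[k _ ->]].
case E: [seq r <- _ | _] => [|r' rs] //; rewrite mem_seq1 => /eqP ->.
have: r' \in [seq r <- T ++ residues T | slot base (rep r) == k].
  by rewrite E mem_head.
by rewrite mem_filter => /andP[].
Qed.

Definition strong_partial T : Prop :=
  [/\ {subset T <= U}, {subset keys_of T <= keys} & uniq (keys_of T)].

Lemma keys_of_moved T : strong_partial T -> [::] \notin keys_of T.
Proof. by case=> _ kT _; apply: contra keys_nil => /kT. Qed.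

Lemma sift_in m T f : {subset T <= U} -> f \in U -> sft m T f \in U.
Proof.
move=> TU fU; elim: m => //= m IH; case: (sift1P T (sft m T f)) => [[-> //]|].
by case=> t [/TU tU _ ->]; apply: U_mul => //; apply: U_inv.
Qed.

Lemma candidates_in T :
  {subset T <= U} -> {subset candidates mulgn gens T <= U}.
Proof.
move=> TU c; rewrite mem_cat => /orP[/U_gens //|/flattenP[r /mapP[s sT ->]]].
by case/mapP=> t tT ->; apply: U_mul; apply: TU.
Qed.

Lemma round_strong T : strong_partial T -> strong_partial (rnd T).
Proof.
case=> TU _ _; split.
- move=> r /round_subset; rewrite mem_cat => /orP[/TU //|/mapP[c cT ->]].
  by apply: sift_in => //; apply: candidates_in cT.
- by move=> k; rewrite round_keys mem_filter => /andP[].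
by rewrite round_keys filter_uniq.
Qed.

Lemma round_keysS T : strong_partial T -> {subset keys_of T <= keys_of (rnd T)}.
Proof.
case=> _ kT _ k kT'; rewrite round_keys mem_filter kT // andbT.
by rewrite /keys_of map_cat mem_cat kT'.
Qed.

(** No element of [U] except 1 can get stuck in sifting. Later rounds preserve this, as they lose no
    key. *)
Definition complete T : Prop := {in U, forall u,
  slot base (rep u) = [::] \/ slot base (rep u) \in keys_of T}.

(** The set [products (size base)] contains the generators, because they sift to the identity, and
    it is closed under multiplication. So it contains [U], and its elements have keys from the
    table. *)
Lemma closed_complete T : strong_partial T ->
  all (fun r => slot base (rep r) == [::]) (residues T) -> complete T.
Proof.
move=> strongT /allP closed u uU; have T0 := keys_of_moved strongT.
have [TU _ _] := strongT.
have Ttot: {in T, forall t, is_total t} by move=> t /TU /U_total.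
have sift_nil c : c \in candidates mulgn gens T ->
    slot base (rep (sft (size base) T c)) = [::].
  by move=> cT; apply/eqP/closed/map_f.
have T_closed: {in T &, forall s t,
    slot base (rep (sft (size base) T (s * t))) = [::]}.
  move=> s t sT tT; apply: sift_nil; rewrite mem_cat; apply/orP; right.
  by apply/flattenP; exists [seq s * t | t <- T]; [exact: map_f | exact: map_f].
apply: (@products_key T Ttot T0 (size base)).
apply: subsetP uU; apply: U_generated.
- exact: products_one.
- move=> g gg; apply: (sift_products Ttot T0 (m := size base)).
  + exact/U_total/U_gens.
  + exact: leq_subr.
  by apply: sift_nil; rewrite mem_cat gg.
exact: products_mul.
Qed.

(** As long as the table is not complete, each round adds a key; one round more than there are keys
    would exhaust them. *)
Definition strong_table : seq (pbij n) := iter (size keys).+1 rnd [::].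

Lemma strong_tableP :
  [/\ {subset strong_table <= U}, [::] \notin keys_of strong_table &
      complete strong_table].
Proof.
have strong m : strong_partial (iter m rnd [::]).
  by elim: m => [|m IH]; [split | apply: round_strong].
have grow m : m <= size (iter m rnd [::]) \/ complete (iter m rnd [::]).
  elim: m => [|m IH]; first by left.
  have [TU kT uT] := strong m; set T := iter m rnd [::] in IH TU kT uT *.
  have keysS := round_keysS (strong m); rewrite -/T in keysS.
  have completeS : complete T -> complete (rnd T).
    by move=> cT u /cT[|/keysS]; [left | right].
  rewrite iterS -/T; case: IH => [le_m|/completeS]; last by right.
  case closed: (all (fun r => slot base (rep r) == [::]) (residues T)).
    by right; apply/completeS/closed_complete.
  (* A residue that still moves a point brings a key that is new by [sift_key]. *)
  left; have/allPn[r rT r0] := negbT closed.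
  have rk: slot base (rep r) \in keys.
    case: (@keys_slot r) r0 => // [|-> //].
    move: rT => /mapP[c cT ->]; apply: U_total; apply: sift_in => //.
    exact: candidates_in cT.
  rewrite -(size_map (fun t => slot base (rep t))) in le_m.
  rewrite -(size_map (fun t => slot base (rep t)) (rnd T)).
  apply: leq_ltn_trans le_m _.
  apply: (@uniq_leq_size _ (slot base (rep r) :: keys_of T)).
    rewrite /= uT andbT; case/mapP: rT => c _ ->.
    apply: sift_key => //; first by move=> t /TU /U_total.
    exact: keys_of_moved (strong m).
  move=> k; rewrite in_cons => /predU1P[->|]; last exact: keysS.
  rewrite -[map _ _]/(keys_of (rnd T)) round_keys mem_filter rk andbT.
  rewrite /keys_of map_cat mem_cat.
  by rewrite (map_f (fun t => slot base (rep t)) rT) orbT.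
have [TU kT uT] := strong (size keys).+1; split=> //.
  exact: keys_of_moved (strong _).
have [|//] := grow (size keys).+1.
rewrite -(size_map (fun t => slot base (rep t))) leqNgt ltnS.
by rewrite (uniq_leq_size uT kT).
Qed.

(** The final residue is a restriction of 1; multiplying the table elements back in reverse order
    turns 1 into an extension of [f]. *)
Lemma sift_extends m T f : {subset T <= U} ->
  slot base (rep (sft m T f)) = [::] -> exists2 u, u \in U & extends u f.
Proof.
move=> TU; elim: m f => [|m IH] f.
  by move=> f0; exists 1 => //; apply: slot_nil_sub1 f0.
rewrite /sift iterSr -/(sift _ _ _ m T _).
case: (sift1P T f) => [[-> _]|[t [tT _ ->]]]; first exact: IH.
move=> /IH[u uU uf]; exists (u * t); first by apply: U_mul => //; apply: TU.
move=> i j; rewrite -{1}(total_mulK f (U_total (TU _ tT))) !(mulE _ t).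
by case fi: ((f * t^-1) i) => [k|] //; rewrite (uf i k).
Qed.

(** The residue has the domain of [f] and an extension [v] in [U]. If it moved a base point, all
    earlier base points would lie in its domain, since the base lists the domain first, so [v] would
    have the same key. By completeness this key is in the table, against [sift_key]. *)
Lemma extends_sift f u :
  (forall i j, i <= j -> j < size base -> nth 0 (rep f) (nth 0 base j) != 0 ->
     nth 0 (rep f) (nth 0 base i) != 0) ->
  u \in U -> extends u f ->
  slot base (rep (sft (size base) strong_table f)) = [::].
Proof.
have [TU T0 cT] := strong_tableP; set T := strong_table in TU T0 cT *.
have Ttot: {in T, forall t, is_total t} by move=> t /TU /U_total.
move=> dom uU uf; apply/eqP/negPn/negP => r0.
have [v [vU vr domr]] : exists v, [/\ v \in U,
    extends v (sft (size base) T f) &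
    forall i, (sft (size base) T f i == None) = (f i == None)].
  elim: (size base) {r0} => [|m [v [vU vr domr]]]; first by exists u.
  rewrite /sift iterS -/(sift _ _ _ m T f).
  case: (sift1P T (sft m T f)) => [[-> _]|[t [tT _ ->]]]; first by exists v.
  exists (v * t^-1); split; first by apply: U_mul => //; apply/U_inv/TU.
    move=> i j; rewrite !mulE.
    by case ri: (sft m T f i) => [k|] //; rewrite (vr _ _ ri).
  move=> i; rewrite -domr mulE; case: (sft m T f i) => //= k.
  by have /totalP/(_ k)[j ->] := total_inv (Ttot _ tT).
have := sift_key Ttot T0 f (leqnn (size base)).
set r := sft _ T f in r0 vr domr *.
have rl: lev r < size base.
  by rewrite ltn_neqAle level_le andbT; apply: contra r0 => /eqP/slot_nil ->.
have nzE g (i : 'I_n) : (nth 0 (rep g) i != 0) = (g i != None).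
  by rewrite nth_rep; case: (g i).
have vrE : slot base (rep v) = slot base (rep r).
  apply: slot_agree => j jl jb.
  pose b := Ordinal (point_lt base_mem jb); rewrite -[nth 0 base j]/(val b).
  case rb: (r b) => [c|]; first by rewrite !nth_rep rb (vr _ _ rb).
  pose b' := Ordinal (point_lt base_mem rl).
  have: r b' != None by rewrite -nzE; case/andP: (moved_level rl).
  have := dom j (lev r) jl rl; rewrite -[nth 0 base j]/(val b).
  by rewrite -[nth 0 base (lev r)]/(val b') !nzE -!domr rb /= => dm /dm.
by rewrite -vrE; case: (cT v vU) => [E|-> //]; move: r0; rewrite -vrE E.
Qed.

End Rounds.

End StrongGeneratingSets.

(** * Factorizability *)

(* As long as a point of the domain of [f] is moved, [f] and any total extension
   of it have the same key. *)
Definition domain_first (f : seq nat) : seq nat :=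
  [seq b <- iota 0 (size f) | nth 0 f b != 0] ++
  [seq b <- iota 0 (size f) | nth 0 f b == 0].

Definition all_slots (m : nat) : seq (seq nat) :=
  flatten [seq [seq [:: b; v.+1] | v <- iota 0 m] | b <- iota 0 m].

Definition group_gens (a : seq (seq nat)) : seq (seq nat) :=
  [seq f <- a | totalL f] ++ [seq invL f | f <- [seq f <- a | totalL f]].

Definition sims_table (base : seq nat) (keys a : seq (seq nat)) :=
  iter (size keys).+1
    (table_round mulL invL (slot base) (size base) keys (group_gens a)) [::].

(** The table is built anew for each [f], because the base depends on the domain of [f]. *)
Definition extendable (a : seq (seq nat)) (f : seq nat) : bool :=
  slot (domain_first f)
    (sift mulL invL (slot (domain_first f)) (size (domain_first f))
       (sims_table (domain_first f) (all_slots (size f)) a) f) == [::].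

Definition all_extendable (a : seq (seq nat)) : bool := all (extendable a) a.

(** * Generated inverse monoids and restrictions of units *)

Section Semigroup.

Local Open Scope group_scope.

Variables (M : finStarMonoidType) (A : {set M}).

Lemma sub_semigroup_gen : A \subset semigroup_gen A.
Proof. by apply/bigcapsP=> B /andP[]. Qed.

Lemma semigroup_gen_mul x y :
  x \in semigroup_gen A -> y \in semigroup_gen A -> x * y \in semigroup_gen A.
Proof.
move=> /bigcapP xA /bigcapP yA; apply/bigcapP=> B BA; have /andP[_ BB] := BA.
by apply: (subsetP BB); rewrite mem_mulg ?xA ?yA.
Qed.

Lemma semigroup_gen_min (P : pred M) :
  {in A, forall x, P x} -> (forall x y, P x -> P y -> P (x * y)) ->
  {in semigroup_gen A, forall x, P x}.
Proof.
move=> PA PM x /bigcapP/(_ [set y | P y]); rewrite inE; apply.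
apply/andP; split.
  by apply/subsetP=> y /PA; rewrite inE.
by apply/subsetP=> _ /mulsgP[y z + + ->]; rewrite !inE; apply: PM.
Qed.

End Semigroup.

Section Factorizable.

Local Open Scope group_scope.

Variables (n : nat) (a : seq (pbij n)).
Implicit Types f g u v s : pbij n.

Local Notation S := (inverse_monoid_gen a).

Lemma gen_in f : f \in a -> f \in S.
Proof.
by move=> fa; apply/(subsetP (sub_semigroup_gen _)); rewrite !inE fa.
Qed.

Lemma inv_gen_in f : f \in a -> f^-1 \in S.
Proof.
move=> fa; apply/(subsetP (sub_semigroup_gen _)); rewrite !inE.
by apply/orP; left; apply/orP; right; apply/imsetP; exists f; rewrite ?inE.
Qed.

Lemma one_in : 1 \in S.
Proof. by apply/(subsetP (sub_semigroup_gen _)); rewrite !inE eqxx orbT. Qed.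

Lemma mul_in s t : s \in S -> t \in S -> s * t \in S.
Proof. exact: semigroup_gen_mul. Qed.

Lemma inverse_monoid_ind (P : pred (pbij n)) :
  {in a, forall f, P f} -> {in a, forall f, P f^-1} -> P 1 ->
  (forall s t, P s -> P t -> P (s * t)) -> {in S, forall s, P s}.
Proof.
move=> Pa PV P1 PM; apply: semigroup_gen_min => // s.
rewrite !inE -orbA => /or3P[/Pa //|/imsetP[f + ->]|/eqP -> //].
exact: PV.
Qed.

Lemma inv_in s : s \in S -> s^-1 \in S.
Proof.
move: s; apply: inverse_monoid_ind => [f /inv_gen_in //|f /gen_in|| s t sS tS].
- by rewrite invgK.
- by rewrite invg1 one_in.
by rewrite invMg mul_in.
Qed.

Lemma units_total u : (u \in units S) = (u \in S) && is_total u.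
Proof.
rewrite inE; case uS: (u \in S) => //=; apply/existsP/idP.
  case=> v /andP[_ /andP[/eqP uv _]].
  have: is_total (u * v) by rewrite uv total_one.
  by case/total_mulP.
move=> uT; exists u^-1; rewrite inv_in //= total_mulV // eqxx /=.
by have := total_mulV (total_inv uT); rewrite invgK => ->.
Qed.

Lemma factorizableP :
  factorizable S <-> {in a, forall f, exists2 u, u \in units S & extends u f}.
Proof.
split=> [SUE f fa | aU].
  have: f \in units S * idempotents S by rewrite -SUE gen_in.
  case/mulsgP=> u e uU eE ->; exists u => // i j.
  move: eE; rewrite inE => /andP[_ /eqP ee].
  rewrite mulE; case ui: (u i) => [k|] //= ek.
  (* An idempotent is the identity on its domain: [e] sends both [k] and [j] to [j]. *)
  have: (e * e) k = Some j by rewrite ee.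
  by rewrite mulE ek /= => ej; rewrite (pbij_inj ek ej).
have SU : {in S, forall s, [exists u in units S,
    [forall i, (s i != None) ==> (u i == s i)]]}.
  apply: inverse_monoid_ind.
  - move=> f /aU[u uU uf]; apply/exists_inP; exists u => //; exact/extendsP.
  - move=> f /aU[u]; rewrite units_total => /andP[uS uT] uf.
    apply/exists_inP; exists u^-1.
      by rewrite units_total inv_in //= total_inv.
    by apply/extendsP=> i j /invE/uf/invE.
  - apply/exists_inP; exists 1; first by rewrite units_total one_in total_one.
    exact/extendsP.
  move=> s t /exists_inP[u uU /extendsP us] /exists_inP[v vU /extendsP vt].
  apply/exists_inP; exists (u * v).
    move: uU vU; rewrite !units_total => /andP[uS uT] /andP[vS vT].
    by rewrite mul_in //=; apply/total_mulP.
  apply/extendsP=> i j; rewrite !mulE.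
  by case si: (s i) => [k|] //= /vt; rewrite (us _ _ si).
apply/setP=> s; apply/idP/mulsgP => [sS | [u e + + ->]]; last first.
  by rewrite units_total inE => /andP[uS _] /andP[eS _]; apply: mul_in.
have/exists_inP[u uU /extendsP us] := SU s sS.
have eS : s^-1 * s \in S by rewrite mul_in ?inv_in.
have eE i : (s^-1 * s) i = obind s (s^-1 i) by rewrite mulE.
(* The idempotent is the partial identity on the image of [s]. It cuts [u] down to [s]: injectivity
   of [u] keeps points outside the domain of [s] away from that image. *)
exists u (s^-1 * s) => //; move: (s^-1 * s) eS eE => e eS eE.
  rewrite inE eS /=; apply/eqP; apply: pbij_ext => i; rewrite mulE eE.
  case si: (s^-1 i) => [k|] //; move/invE: (si) => ki /=.
  by rewrite ki /= eE si /= ki.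
apply: pbij_ext => i; rewrite mulE; case si: (s i) => [j|].
  by rewrite (us _ _ si) /= eE; move/invE: (si) => -> /=.
case ui: (u i) => [j|] //; rewrite /= eE; case sj: (s^-1 j) => [k|] //=.
move/invE: sj => sk; have ki := pbij_inj ui (us _ _ sk).
by rewrite -ki si in sk.
Qed.

End Factorizable.

(** * Correctness of the extension test on lists *)

Section Correctness.

Local Open Scope group_scope.

Variables (n : nat) (a : seq (pbij n)).

Local Notation S := (inverse_monoid_gen a).

Definition total_gens : seq (pbij n) :=
  [seq f <- a | is_total f] ++ [seq f^-1 | f <- [seq f <- a | is_total f]].

Lemma total_gens_rep : group_gens (map (@rep n) a) = map (@rep n) total_gens.
Proof.
rewrite /group_gens map_cat filter_map.
have -> : [seq f <- a | preim (@rep n) totalL f] = [seq f <- a | is_total f].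
  by apply: eq_filter => f /=; rewrite totalL_rep.
by congr (_ ++ _); rewrite -!map_comp; apply: eq_map => f /=; rewrite rep_inv.
Qed.

(** Factors of a total product are total, so generators that are not permutations never occur in a
    product that is a unit. *)
Lemma units_generated (W : {set pbij n}) :
  1 \in W -> {subset total_gens <= W} -> W * W \subset W -> units S \subset W.
Proof.
move=> W1 Wg /subsetP WW; apply/subsetP=> u; rewrite units_total => /andP[uS].
move: u uS; suff: {in S, forall u, is_total u ==> (u \in W)}.
  by move=> SW u /SW/implyP.
apply: inverse_monoid_ind.
- move=> f fa; apply/implyP=> fT; apply: Wg.
  by rewrite mem_cat mem_filter fT fa.
- move=> f fa; apply/implyP=> /total_inv; rewrite invgK => fT; apply: Wg.
  by rewrite mem_cat; apply/orP; right; apply: map_f; rewrite mem_filter fT fa.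
- by rewrite W1 implybT.
move=> s t /implyP sW /implyP tW; apply/implyP=> /total_mulP[sT tT].
by apply: WW; rewrite mem_mulg ?sW ?tW.
Qed.

Section Base.

Variable base : seq nat.
Hypothesis base_perm : perm_eq base (iota 0 n).

Local Notation keys := (all_slots n).

Lemma all_slots_uniq : uniq keys.
Proof.
rewrite /all_slots; apply: allpairs_uniq; rewrite ?iota_uniq //.
by move=> [b v] [b' v'] _ _ /= [-> ->].
Qed.

Lemma all_slots_nil : [::] \notin keys.
Proof. by apply/flattenP=> -[s /mapP[b _ ->] /mapP[]]. Qed.

Lemma slot_in_all (f : pbij n) :
  slot base (rep f) = [::] \/ slot base (rep f) \in keys.
Proof.
have base_mem := perm_mem base_perm.
rewrite slotE; case: ifP => fb; [right|by left].
have bn := point_lt base_mem fb.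
have := moved_level fb.
rewrite /moved -[nth 0 base _]/(val (Ordinal bn)) nth_rep.
case: ((f : {ffun _ -> _}) _) => [j|] // _; apply/flattenP.
exists [seq [:: nth 0 base (level base f); v.+1] | v <- iota 0 n].
  by apply: map_f; rewrite mem_iota.
by apply: map_f; rewrite mem_iota /=.
Qed.

Lemma sims_table_rep :
  sims_table base keys (map (@rep n) a) =
  map (@rep n) (strong_table base keys total_gens).
Proof.
rewrite /sims_table /strong_table total_gens_rep.
elim: (size keys).+1 => //= m ->.
apply: table_round_rep => //; [exact: rep_mul | exact: rep_inv].
Qed.

End Base.

Lemma domain_first_perm (f : pbij n) :
  perm_eq (domain_first (rep f)) (iota 0 n).
Proof.
rewrite /domain_first size_rep.
apply: perm_trans (permEl (perm_filterC (fun b => nth 0 (rep f) b != 0) _)).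
rewrite perm_cat2l; have -> // : [seq b <- iota 0 n | nth 0 (rep f) b == 0] =
  [seq b <- iota 0 n | predC (fun b => nth 0 (rep f) b != 0) b].
by apply: eq_filter => b /=; rewrite negbK.
Qed.

Lemma domain_first_nth (f : seq nat) i j :
  i <= j -> j < size (domain_first f) ->
  nth 0 f (nth 0 (domain_first f) j) != 0 ->
  nth 0 f (nth 0 (domain_first f) i) != 0.
Proof.
rewrite /domain_first; set D := [seq b <- _ | _].
set E := [seq b <- _ | _ == 0].
move=> ij jl; rewrite !nth_cat; case: ltnP => [jD|Dj].
  have iD := leq_ltn_trans ij jD; rewrite iD.
  by have := mem_nth 0 iD; rewrite mem_filter => /andP[].
have: nth 0 E (j - size D) \in E.
  by rewrite mem_nth // -(ltn_add2l (size D)) subnKC // -size_cat.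
by rewrite mem_filter => /andP[->].
Qed.

Lemma extendable_rep (f : pbij n) :
  reflect (exists2 u, u \in units S & extends u f)
          (extendable (map (@rep n) a) (rep f)).
Proof.
rewrite /extendable size_rep; set base := domain_first (rep f).
have bp : perm_eq base (iota 0 n) := domain_first_perm f.
have base_uniq : uniq base by rewrite (perm_uniq bp) iota_uniq.
have base_mem := perm_mem bp.
rewrite sims_table_rep (sift_rep (mulE := fun f g : pbij n => f * g)
  (invE := fun f : pbij n => f^-1)
  (keyE := fun f : pbij n => slot base (rep f))) //; last 2 first.
- exact: rep_mul.
- exact: rep_inv.
have U_total : {in units S, forall u, is_total u}.
  by move=> u; rewrite units_total => /andP[].
have U_one : 1 \in units S by rewrite units_total one_in total_one.
have U_mul : {in units S &, forall u v, u * v \in units S}.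
  move=> u v; rewrite !units_total => /andP[uS uT] /andP[vS vT].
  by rewrite mul_in //=; apply/total_mulP.
have U_inv : {in units S, forall u, u^-1 \in units S}.
  by move=> u; rewrite !units_total => /andP[uS uT]; rewrite inv_in ?total_inv.
have U_gens : {subset total_gens <= units S}.
  move=> u; rewrite mem_cat units_total => /orP[|/mapP[v + ->]];
    rewrite mem_filter => /andP[fT fa]; first by rewrite gen_in.
  by rewrite inv_gen_in ?total_inv.
have [TU _ _] := strong_tableP base_uniq base_mem all_slots_uniq
  all_slots_nil (fun g _ => slot_in_all bp g) U_total U_mul U_inv
  U_gens units_generated.
apply: (iffP eqP) => [|[u uU uf]].
  exact: sift_extends.
apply: extends_sift uU uf => //; first exact: all_slots_uniq.
- exact: all_slots_nil.
- by move=> g _; apply: slot_in_all.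
- exact: units_generated.
exact: domain_first_nth.
Qed.

Theorem all_extendableP : all_extendable (map (@rep n) a) <-> factorizable S.
Proof.
rewrite factorizableP /all_extendable all_map; split=> [/allP aE f fa|aE].
  exact/extendable_rep/aE.
by apply/allP=> f /aE; apply: (introT (extendable_rep f)).
Qed.

End Correctness.

(** * Running time of the algorithm *)

Lemma ptime_slot : ptime (fun p : seq nat * seq nat => slot p.1 p.2).
Proof.
by rewrite /slot; ptime_tac.
Qed.

(* Polynomial time requires size bounds on all inputs, including lists that do
   not represent partial bijections. *)
Definition small (B : nat) (f : seq nat) : bool :=
  (size f <= B) && all (fun v => v <= B) f.

Lemma esize_small B f : small B f -> esize f <= B * (2 * B + 2) + 1.
Proof.
case/andP=> fB /allP vB; apply: leq_trans (esize_seq_le fB (B := B.*2.+1) _) _.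
  by move=> j jf v0; rewrite esize_nat ltnS leq_double; apply/vB/mem_nth.
by rewrite -addnn; lia.
Qed.

Lemma small_esize B f : esize f <= B -> small B f.
Proof.
move=> fB; apply/andP; split; first by have := @size_le_esize _ enc_nat f; lia.
apply/allP=> v vf; have vE : esize v <= esize f by apply: esize_mem.
by rewrite esize_nat in vE; lia.
Qed.

Lemma small_mem B f T : f \in T -> esize T <= B -> small B f.
Proof.
move=> fT TB; apply: small_esize; apply: leq_trans TB.
exact: esize_mem.
Qed.

(** The entries of the product are 0 or entries of [g], and its length is that of [f]. This is true
    of arbitrary lists, so one bound survives any number of products. *)
Lemma small_mulL B f g : small B f -> small B g -> small B (mulL f g).
Proof.
move=> /andP[fB _] /andP[_ /allP gB]; rewrite /small size_map fB all_map.
apply/allP=> v _ /=; case: v => //= v.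
by case: (ltnP v (size g)) => [vg|gv]; [apply/gB/mem_nth | rewrite nth_default].
Qed.

Lemma small_invL B g : small B g -> small B (invL g).
Proof.
move=> /andP[gB _]; rewrite /small size_map size_iota gB all_map.
apply/allP=> j _ /=; case: eqP => // /eqP jg.
by apply: leq_trans gB; rewrite ltn_neqAle jg index_size.
Qed.

Lemma small_sift B base m T g : all (small B) T -> small B g ->
  small B (sift mulL invL (slot base) m T g).
Proof.
move=> /allP TB gB; elim: m => //= m IH; rewrite /sift1.
case E: [seq _ <- _ | _] => [|t r]; first exact: IH.
apply: small_mulL; first exact: IH.
apply/small_invL/TB; have := mem_head t r; rewrite -E mem_filter.
by case/andP.
Qed.

Lemma ptime_sift_on :
  ptime (fun p : (seq nat * nat) * (seq (seq nat) * seq nat) =>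
  sift mulL invL (slot p.1.1) p.1.2 p.2.1 p.2.2).
Proof.
apply: (ptime_iter (f := fun p g => sift1 mulL invL (slot p.1.1) p.2.1 g)
  (v := fun p => esize p * (2 * esize p + 2) + 1)); try by ptime_tac.
  by pbound_tac.
move=> [[base m] [T g]] j _; apply: esize_small.
apply: small_sift; last by apply: small_esize; rewrite !esize_pair /=; lia.
by apply/allP=> t /small_mem; apply; rewrite !esize_pair /=; lia.
Qed.

Lemma ptime_sift {X : Type} {eX : encodable X} (base : X -> seq nat)
    (m : X -> nat) (T : X -> seq (seq nat)) (g : X -> seq nat) :
  ptime base -> ptime m -> ptime T -> ptime g ->
  ptime (fun x => sift mulL invL (slot (base x)) (m x) (T x) (g x)).
Proof.
move=> bP mP TP gP.
exact: (ptime_comp ptime_sift_on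
  (ptime_pair (ptime_pair bP mP) (ptime_pair TP gP))).
Qed.

Lemma ptime_candidates : ptime (fun p : seq (seq nat) * seq (seq nat) =>
  candidates mulL p.1 p.2).
Proof.
rewrite /candidates; ptime_tac.
Qed.

Lemma ptime_round :
  ptime (fun p : (seq nat * seq (seq nat)) * (seq (seq nat) * seq (seq nat)) =>
  table_round mulL invL (slot p.1.1) (size p.1.1) p.1.2 p.2.1 p.2.2).
Proof.
rewrite /table_round; apply: ptime_flatten.
apply: ptime_map; first by ptime_tac.
apply: ptime_match; try by ptime_tac.
apply: ptime_filter.
  apply: ptime_cat; first by ptime_tac.
  apply: ptime_map; last by apply: ptime_sift; ptime_tac.
  by apply: (ptime_comp2 (h := candidates mulL) ptime_candidates); ptime_tac.
apply: ptime_eq_seq_nat; last by ptime_tac.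
by apply: (ptime_comp2 (h := slot) ptime_slot); ptime_tac.
Qed.

Lemma ptime_group_gens : ptime group_gens.
Proof.
by rewrite /group_gens; ptime_tac.
Qed.

Lemma small_group_gens B a : esize a <= B -> all (small B) (group_gens a).
Proof.
move=> aB; rewrite /group_gens all_cat all_map.
apply/andP; split; apply/allP=> f;
  rewrite mem_filter => /andP[_ /small_mem fB]; first exact: fB.
by apply/small_invL/fB.
Qed.

Lemma small_round B base m keys gens T :
  all (small B) gens -> all (small B) T ->
  all (small B) (table_round mulL invL (slot base) m keys gens T).
Proof.
move=> gB TB; apply/allP=> r /flattenP[s /mapP[k _ ->]].
case E: [seq _ <- _ | _] => [|r' rs] //; rewrite mem_seq1 => /eqP ->.
have := mem_head r' rs; rewrite -E mem_filter => /andP[_].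
rewrite mem_cat => /orP[/(allP TB) //|/mapP[c cT ->]].
apply: small_sift => //; move: cT; rewrite mem_cat => /orP[/(allP gB) //|].
case/flattenP=> _ /mapP[s' s'T ->] /mapP[t tT ->].
by apply: small_mulL; apply: (allP TB).
Qed.

Lemma size_round base m keys gens T :
  size (table_round mulL invL (slot base) m keys gens T) <= size keys.
Proof.
rewrite /table_round; elim: keys => //= k ks IH; rewrite size_cat.
by case: [seq _ <- _ | _] => [|r rs] /=; lia.
Qed.

(** A round outputs at most one list for each key, and all lists stay small, so the table is bounded
    independently of the number of rounds. *)
Lemma ptime_sims_table :
  ptime (fun p : (seq nat * (seq (seq nat) * seq (seq nat))) =>
    sims_table p.1 p.2.1 p.2.2).
Proof.
apply: (ptime_iter
  (v := fun p => esize p * (esize p * (2 * esize p + 2) + 1).+1 + 1)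
  (f := fun p T => table_round mulL invL (slot p.1) (size p.1) p.2.1
     (group_gens p.2.2) T)).
- by ptime_tac.
- by ptime_tac.
- have h := ptime_round.
  apply: (ptime_comp (f := fun q : (seq nat * (seq (seq nat) * seq (seq nat))) *
     seq (seq nat) => ((q.1.1, q.1.2.1), (group_gens q.1.2.2, q.2))) h).
  ptime_tac; apply: (ptime_comp ptime_group_gens); by ptime_tac.
- by apply: (@pbound_le _ _ _
    (fun p => esize p * (esize p * (2 * esize p + 2) + 2) + 1));
    [pbound_tac | move=> p; rewrite -addn1 -addnA].
move=> [base [keys a]] j _.
set T := iter _ _ _; set B := esize (base, (keys, a)).
have aB: esize a <= B by rewrite /B !esize_pair; lia.
have [szT TB]: size T <= B /\ all (small B) T.
  rewrite /T; case: j {T} => [|j] //=; split.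
    apply: leq_trans (size_round _ _ _ _ _) _.
    have : size keys < esize keys by apply: size_le_esize.
    by rewrite /B !esize_pair; lia.
  elim: j => [|j IH]; apply: small_round => //; exact: small_group_gens.
apply: esize_seq_le => // k kT f0; apply/esize_small/(allP TB)/mem_nth => //.
Qed.

Lemma ptime_domain_first : ptime domain_first.
Proof. by rewrite /domain_first; ptime_tac. Qed.

Lemma ptime_all_slots : ptime all_slots.
Proof. by rewrite /all_slots; ptime_tac. Qed.

Lemma ptime_extendable :
  ptime (fun p : seq (seq nat) * seq nat => extendable p.1 p.2).
Proof.
have dP : ptime (fun p : seq (seq nat) * seq nat => domain_first p.2).
  exact: (ptime_comp ptime_domain_first ptime_snd).
rewrite /extendable; apply: ptime_eq_seq_nat; last by ptime_tac.
apply: (ptime_comp2 (h := slot) ptime_slot) => //.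
apply: ptime_sift => //; [by apply: ptime_size | | exact: ptime_snd].
apply: (ptime_comp3 (h := sims_table) ptime_sims_table) => //.
  by apply: (ptime_comp ptime_all_slots); ptime_tac.
exact: ptime_fst.
Qed.

Theorem ptime_all_extendable : ptime all_extendable.
Proof.
by rewrite /all_extendable; apply: ptime_all;
  [ptime_tac | exact: ptime_extendable].
Qed.

(** * Words encoding instances *)

Definition terminated (c : letter) (segs : seq (seq letter)) : seq letter :=
  flatten [seq s ++ [:: c] | s <- segs].

(** Letters after the last separator are lost; words that have any are rejected by the comparison in
    [decide_word] or [decide_lists]. *)
Definition segments (c : letter) (w : seq letter) : seq (seq letter) :=
  foldr (fun x st => if x == c then [::] :: st
                     else if st is s :: st' then (x :: s) :: st' else [::])
        [::] w.

Lemma segments_terminated c segs : all (fun s => c \notin s) segs ->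
  segments c (terminated c segs) = segs.
Proof.
rewrite /segments /terminated; elim: segs => //= s segs IH /andP[cs csegs].
rewrite -catA foldr_cat /= eqxx IH //.
elim: s cs => //= x s IHs; rewrite inE negb_or eq_sym => /andP[/negPf xc cs].
by rewrite xc IHs.
Qed.

Fixpoint incr (s : seq letter) : seq letter :=
  if s is d :: r then
    if d == inl true then inl false :: incr r else inl true :: r
  else [:: inl true].

(** Counting upwards avoids arithmetic on binary words; [m] increments are affordable, [m] being
    given in unary. *)
Definition numeral (m : nat) : seq letter := iter m incr [:: inl false].

Arguments binary : simpl never.

Lemma binaryE m : binary m =
  inl (odd m) :: (if m < 2 then [::] else binary m./2).
Proof.
rewrite /binary; case: ltnP => [|m2]; first by case: m => [|[|]].
have iotaS k : iota 0 k.+1 = 0 :: map (addn 1) (iota 0 k) by rewrite -iotaDl.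
rewrite trunc_log2S // [in LHS]iotaS map_cons expn0 divn1 -map_comp.
congr (_ :: _); apply: eq_map => i /=.
by rewrite expnD expn1 divnMA divn2.
Qed.

Lemma incr_binary m : incr (binary m) = binary m.+1.
Proof.
have [k] := ubnP m; elim: k m => // k IH m mk.
rewrite binaryE (binaryE m.+1).
case: (ltnP m 2) => [|m2]; first by case: m {mk} => [|[|]].
have -> : (m.+1 < 2) = false by lia.
have : incr (binary m./2) = binary m./2.+1.
  by apply: IH; lia.
rewrite -[m.+1./2]/(uphalf m) uphalf_half [odd m.+1]/=.
have incrE d r : incr (d :: r) =
  if d == inl true then inl false :: incr r else inl true :: r by [].
by move=> h; rewrite (incrE (inl (odd m)) (binary m./2)) h; case: (odd m).
Qed.

Lemma numeralE m : numeral m = binary m.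
Proof.
by elim: m => // m IH; rewrite /numeral iterS -/(numeral m) IH incr_binary.
Qed.

Definition value (s : seq letter) : nat :=
  foldr (fun d v => (d == inl true) + v.*2) 0 s.

Lemma binaryK : cancel binary value.
Proof.
move=> m; have [k] := ubnP m; elim: k m => // k IH m mk.
rewrite binaryE /=; case: ltnP => [|m2]; first by case: m {mk} => [|[|]].
rewrite IH; first by rewrite -[RHS]odd_double_half; case: (odd m).
by lia.
Qed.

Definition is_digit (x : letter) : bool := (x != comma) && (x != semicolon).

(** The last digit is the most significant one, so apart from the single digit 0 an expansion
    without leading zeros ends in 1. *)
Definition is_numeral (h : seq letter) : bool :=
  all is_digit h && ((h == [:: inl false]) || (last (inl false) h == inl true)).

Lemma binary_digits m : all is_digit (binary m).
Proof. by rewrite /binary all_map; apply/allP. Qed.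

Lemma last_binary m : 0 < m -> last (inl false) (binary m) = inl true.
Proof.
have [k] := ubnP m; elim: k m => // k IH m mk m0.
rewrite binaryE /=; case: ltnP => [|m2]; first by case: m m0 {mk} => [|[|]].
have h0 : 0 < m./2 by case: m m2 {mk m0} => [|[|]].
have := IH m./2 _ h0; rewrite binaryE /=; apply.
by lia.
Qed.

Lemma is_numeralP h : reflect (exists m, h = binary m) (is_numeral h).
Proof.
apply: (iffP idP) => [|[m ->]]; last first.
  rewrite /is_numeral binary_digits; case: (posnP m) => [-> //|m0].
  by rewrite last_binary // eqxx orbT.
elim: h => [|d h IH] /andP[] //= /andP[dd hd].
have [b ->] : exists b, d = inl b by case: d dd => [b|[]] //; exists b.
case: h IH hd => [|e h] IH hd.
  by move=> _; exists b; case: b {dd}.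
rewrite eqseq_cons andbF /= => hl.
have [|m hE] := IH; first by rewrite /is_numeral hd /= hl orbT.
exists (b + m.*2); rewrite binaryE hE oddD odd_double addbF half_bit_double.
have -> : (b + m.*2 < 2) = false.
  case: m hE => [[eE hE]|m _]; first by rewrite eE hE in hl.
  by rewrite doubleS; lia.
by case: b.
Qed.

(** The value [m.+1] is the index that [read_lists] produces for a word missing from the table of
    numerals. The last clause is injectivity: each nonzero value stands at its first occurrence. *)
Definition valid (m : nat) (f : seq nat) : bool :=
  [&& size f == m, all (fun v => v != m.+1) f &
      all (fun i => (nth 0 f i == 0) || (index (nth 0 f i) f == i)) (iota 0 m)].

Definition commas (tab : seq (seq letter)) (f : seq nat) : seq letter :=
  terminated comma [seq nth [::] tab v | v <- f].

Definition numerals (m : nat) : seq (seq letter) :=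
  [seq numeral v | v <- iota 0 m.+1].

(** Because [w] is compared with the encoding of what was read, reading only has to be right on
    genuine encodings. *)
Definition decide_lists (w : seq letter) (m : nat) (tab : seq (seq letter))
    (fs : seq (seq nat)) : bool :=
  [&& all (valid m) fs,
      w == terminated semicolon (nth [::] tab m :: [seq commas tab f | f <- fs])
    & all_extendable fs].

Definition read_lists (tab rs : seq (seq letter)) : seq (seq nat) :=
  [seq [seq index e tab | e <- segments comma r] | r <- rs].

Definition decide_segments (w : seq letter) (m : nat) (rs : seq (seq letter)) :=
  decide_lists w m (numerals m) (read_lists (numerals m) rs).

(* When no partial bijection is given, [n] may be exponential in the length of
   the word, so that only the form of its numeral is tested. Otherwise [n] is
   the number of entries of the first list. *)
Definition decide_word (w : seq letter) : bool :=
  let segs := segments semicolon w in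
  if behead segs is r :: _ then
    decide_segments w (size (segments comma r)) (behead segs)
  else is_numeral (head [::] segs) &&
    (w == terminated semicolon [:: head [::] segs]).

Lemma validP m f : all (fun v => v <= m.+1) f -> valid m f ->
  exists g : pbij m, rep g = f.
Proof.
move=> /allP le_f /and3P[/eqP szf /allP lt_f /allP inj_f].
have fP i v : nth 0 f i = v.+1 -> v < m.
  move=> fi; have vf: v.+1 \in f.
    rewrite -fi mem_nth // ltnNge; apply/negP=> /(nth_default 0).
    by rewrite fi.
  by rewrite -ltnS ltn_neqAle lt_f //=; apply: le_f.
pose F : {ffun 'I_m -> option 'I_m} :=
  [ffun i : 'I_m => if nth 0 f i is v.+1 then insub v else None].
have FE (i j : 'I_m) : F i = Some j -> nth 0 f i = j.+1.
  by rewrite ffunE; case: (nth 0 f i) => // v; case: insubP => // k _ <- [->].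
have Finj : partial_injective F.
  apply/partial_injectiveP=> i k j /FE fi /FE fk; apply: val_inj.
  have idx l z : l < m -> nth 0 f l = z.+1 -> index z.+1 f = l.
    by move=> lm fl; have := inj_f l; rewrite mem_iota lm fl /= => /(_ isT)/eqP.
  exact: etrans (esym (idx i j (ltn_ord i) fi)) (idx k j (ltn_ord k) fk).
exists (PBij Finj); apply: (@eq_from_nth _ 0); rewrite size_rep ?szf // => i im.
rewrite -[i]/(val (Ordinal im)) nth_rep /= ffunE /=.
case fi: (nth 0 f i) => [|v] //; have vm := fP _ _ fi.
by rewrite insubT.
Qed.

Lemma valid_rep m (g : pbij m) : valid m (rep g).
Proof.
rewrite /valid size_rep eqxx /=; apply/andP; split.
  rewrite all_map; apply/allP=> i _ /=; case: ((g : {ffun _ -> _}) i) => //= j.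
  by rewrite eqSS; have := ltn_ord j; lia.
apply/allP=> i; rewrite mem_iota /= => im.
rewrite -[i]/(val (Ordinal im)); set k := Ordinal im.
case gk: (g k) => [j|]; last by rewrite nth_rep gk.
apply/orP; right; have /rep_someP/eqP -> := gk.
have jm : index j.+1 (rep g) < m.
  by have := mem_rep gk; rewrite -index_mem size_rep.
have/rep_someP gi : nth 0 (rep g) (Ordinal jm) == j.+1.
  by rewrite /= nth_index // (mem_rep gk).
by rewrite -[index _ _]/(val (Ordinal jm)) (pbij_inj gi gk).
Qed.

Lemma size_numerals m : size (numerals m) = m.+1.
Proof. by rewrite size_map size_iota. Qed.

Lemma nth_numerals m v : v <= m -> nth [::] (numerals m) v = binary v.
Proof.
by move=> vm; rewrite (nth_map 0) ?size_iota // nth_iota // numeralE.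
Qed.

Lemma index_numerals m v : v <= m -> index (binary v) (numerals m) = v.
Proof.
move=> vm; rewrite /numerals (eq_map numeralE) index_map;
  last exact: can_inj binaryK.
rewrite -[X in index X _](nth_iota 0 0 (ltnSE vm : v < m.+1)).
by rewrite index_uniq ?size_iota ?iota_uniq.
Qed.

Lemma rep_le n (f : pbij n) v : v \in rep f -> v <= n.
Proof.
by case/mapP=> i _ ->; case: ((f : {ffun _ -> _}) i) => // j; apply: ltn_ord.
Qed.

Lemma commas_rep n (f : pbij n) :
  commas (numerals n) (rep f) = terminated comma [seq binary v | v <- rep f].
Proof.
by congr terminated; apply/eq_in_map=> v /rep_le; apply: nth_numerals.
Qed.

Lemma encode_instanceE n (a : seq (pbij n)) : encode_instance a =
  terminated semicolon (binary n :: [seq commas (numerals n) (rep f) | f <- a]).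
Proof.
rewrite /encode_instance -cats1 /terminated.
rewrite -[RHS]/((binary n ++ [:: semicolon]) ++ flatten
  [seq s ++ [:: semicolon] | s <- [seq commas (numerals n) (rep f) | f <- a]]).
rewrite -map_comp; congr (_ ++ flatten _).
apply: eq_map => f /=; rewrite commas_rep /encode_pbij -cats1; congr (_ ++ _).
rewrite /terminated /rep -!map_comp; congr flatten; apply: eq_map => i /=.
by rewrite -cats1 /encode_value; case: ((f : {ffun _ -> _}) i).
Qed.

Lemma segments_instance n (a : seq (pbij n)) :
  segments semicolon (encode_instance a) =
  binary n :: [seq commas (numerals n) (rep f) | f <- a].
Proof.
have notin m : semicolon \notin binary m.
  by apply/negP=> /(allP (binary_digits m)).
rewrite encode_instanceE segments_terminated //= notin all_map.
apply/allP=> f _ /=.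
rewrite commas_rep; apply/negP=> /flattenP[s /mapP[_ /mapP[v _ ->] ->]].
by rewrite mem_cat (negPf (notin v)).
Qed.

Lemma segments_commas n (f : pbij n) :
  segments comma (commas (numerals n) (rep f)) = [seq binary v | v <- rep f].
Proof.
rewrite commas_rep segments_terminated // all_map; apply/allP=> v _ /=.
by apply/negP=> /(allP (binary_digits v)).
Qed.

Lemma read_lists_rep n (a : seq (pbij n)) :
  read_lists (numerals n) [seq commas (numerals n) (rep f) | f <- a] =
  map (@rep n) a.
Proof.
rewrite /read_lists -map_comp; apply: eq_map => f /=.
rewrite segments_commas -map_comp -[RHS]map_id; apply/eq_in_map=> v /rep_le /=.
exact: index_numerals.
Qed.

Lemma decide_wordP w : decide_word w <->
  exists (n k : nat) (a : k.-tuple (pbij n)),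
    w = encode_instance a /\ factorizable (inverse_monoid_gen a).
Proof.
split=> [|[n [k [a [-> Sf]]]]]; last first.
  rewrite /decide_word segments_instance [behead _]/= [head _ _]/=.
  case aE: (tval a) => [|f b].
    rewrite encode_instanceE eqxx andbT; apply/is_numeralP; by exists n.
  change (decide_segments (encode_instance (f :: b))
    (size (segments comma (commas (numerals n) (rep f))))
    [seq commas (numerals n) (rep g) | g <- f :: b]).
  rewrite -aE segments_commas size_map size_rep /decide_segments read_lists_rep.
  rewrite /decide_lists nth_numerals //.
  apply/and3P; split; last exact/all_extendableP.
    by rewrite all_map; apply/allP=> g _; apply: valid_rep.
  by rewrite encode_instanceE -map_comp.
rewrite /decide_word; case sE: (behead _) => [|r rs].
  case/andP=> /is_numeralP[n ->] /eqP ->.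
  (* Without generators every generator extends, so only the shape of the word matters. *)
  exists n, 0, [tuple of [::]]; rewrite encode_instanceE; split=> //.
  exact/all_extendableP.
(* How [m] was found is irrelevant for soundness: the comparison with [w] includes the leading
   numeral. *)
move: (size _) => m; rewrite /decide_segments /decide_lists.
set fs := read_lists _ _ => /and3P[fs_valid /eqP wE fsA].
have [a aE] : exists a : seq (pbij m), map (@rep m) a = fs.
  move: fs_valid; rewrite /fs.
  elim: (r :: rs) => [_|s ss IH]; first by exists [::].
  move=> /= /andP[sv /IH[b bE]].
  have [|g gE] := validP _ sv; last by exists (g :: b); rewrite /= gE bE.
  rewrite all_map; apply/allP=> e _.
  by have := index_size e (numerals m); rewrite size_numerals.
exists m, (size a), (in_tuple a); split; last first.
  by apply/all_extendableP; rewrite aE.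
by rewrite encode_instanceE wE -aE -map_comp nth_numerals.
Qed.

(** * Running time of decoding and encoding *)

Lemma ptime_terminated (c : letter) : ptime (terminated c).
Proof. by rewrite /terminated; ptime_tac. Qed.

Lemma segments_cons c x w : segments c (x :: w) =
  if x == c then [::] :: segments c w
  else if segments c w is s :: st then (x :: s) :: st else [::].
Proof. by []. Qed.

Lemma ptime_segments (c : letter) : ptime (segments c).
Proof.
apply: (ptime_foldr (l := id) (i := fun _ => [::])
  (v := fun w => esize w + esize w)
  (step := fun _ x st => if x == c then [::] :: st
     else if st is s :: st' then (x :: s) :: st' else [::])).
- by ptime_tac.
- by ptime_tac.
- apply: ptime_if.
  + by apply: ptime_eq_letter; ptime_tac.
  + by ptime_tac.
  by apply: ptime_match; ptime_tac.
- by pbound_tac.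
move=> w j; rewrite -/(segments c (drop j w)).
apply: (@leq_trans (esize (drop j w) + esize (drop j w))); last first.
  by apply: leq_add; apply: esize_drop.
elim: (drop j w) => [|x v IH] //; rewrite segments_cons.
case: ifP => _.
  rewrite !esize_cons esize_nil.
  by move: (esize (segments c v)) (esize v) (esize x) IH => E V L; lia.
case: (segments c v) IH => [|s st]; rewrite !esize_cons ?esize_nil.
  by move: (esize v) (esize x) => V L; lia.
by move: (esize s) (esize st) (esize v) (esize x) => S T V L; lia.
Qed.

(** Once there is no carry, [incr] returns the tail unprocessed, so the fold has to carry the tail
    beside the result. *)
Lemma incr_foldr s :
  foldr (fun d st =>
    (if d == inl true then inl false :: st.1 else inl true :: st.2, d :: st.2))
    ([:: inl true], [::]) s = (incr s, s).
Proof. by elim: s => //= d s ->. Qed.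

Lemma esize_letter (x : letter) : esize x <= 7.
Proof. by case: x => -[]. Qed.

Lemma esize_word (w : seq letter) : esize w <= 8 * size w + 1.
Proof.
elim: w => [|x w IH]; first by rewrite esize_nil.
rewrite esize_cons /=; move: (esize_letter x) IH.
by move: (esize x) (esize w) (size w) => L E n; lia.
Qed.

Lemma size_incr s : size (incr s) <= (size s).+1.
Proof. by elim: s => //= d s IH; case: ifP => _ /=; rewrite ?ltnS. Qed.

Lemma ptime_incr : ptime incr.
Proof.
apply: (ptime_ext (f := fun w => (foldr (fun d st =>
   (if d == inl true then inl false :: st.1 else inl true :: st.2, d :: st.2))
   ([:: inl true], [::]) w).1)) => [w|]; first by rewrite incr_foldr.
apply: ptime_fst_of.
apply: (ptime_foldr (l := id) (i := fun _ => ([:: inl true], [::]))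
  (v := fun w => 9 + 9 * esize w + esize w + 1)
  (step := fun _ d st =>
    (if d == inl true then inl false :: st.1 else inl true :: st.2, d :: st.2))).
- by ptime_tac.
- by ptime_tac.
- apply: ptime_pair; last by ptime_tac.
  by apply: ptime_if; [apply: ptime_eq_letter | |]; ptime_tac.
- by pbound_tac.
move=> w j; rewrite incr_foldr esize_pair.
have le_w : esize (drop j w) <= esize w by apply: esize_drop.
have lt_w : size (drop j w) < esize (drop j w) by apply: size_le_esize.
move: (esize_word (incr (drop j w))) (size_incr (drop j w)) lt_w le_w.
move: (esize (incr _)) (size (incr _)) (esize (drop _ _)) (size (drop _ _)).
move: (esize w).
by move=> a b c d e; lia.
Qed.

Lemma ptime_numeral : ptime numeral.
Proof.
apply: (ptime_iter (n := id) (i := fun _ => [:: inl false]) (f := fun _ => incr)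
  (v := fun m => 8 * esize m + 9)).
- by ptime_tac.
- by ptime_tac.
- exact: (ptime_comp ptime_incr ptime_snd).
- by pbound_tac.
move=> m j jm; rewrite esize_nat.
have szj : size (iter j incr [:: inl false]) <= j.+1.
  by elim: j {jm} => //= j IH; apply: leq_trans (size_incr _) _.
move: (esize_word (iter j incr [:: inl false])) szj.
by move: (esize (iter _ _ _)) (size _) => a b; lia.
Qed.

Lemma ptime_numerals : ptime numerals.
Proof.
rewrite /numerals; apply: ptime_map; first by apply: ptime_iota; ptime_tac.
exact: (ptime_comp ptime_numeral ptime_snd).
Qed.

Lemma ptime_is_numeral : ptime is_numeral.
Proof.
rewrite /is_numeral; apply: ptime_andb; first by rewrite /is_digit; ptime_tac.
apply: ptime_orb; first by ptime_tac.
by apply: ptime_eq_letter; [apply: ptime_last | ]; ptime_tac.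
Qed.

Lemma ptime_valid : ptime (fun p : nat * seq nat => valid p.1 p.2).
Proof. by rewrite /valid; ptime_tac. Qed.

Lemma ptime_commas :
  ptime (fun p : seq (seq letter) * seq nat => commas p.1 p.2).
Proof.
rewrite /commas; apply: (ptime_comp (ptime_terminated comma)).
by ptime_tac.
Qed.

Lemma ptime_read_lists :
  ptime (fun p : seq (seq letter) * seq (seq letter) => read_lists p.1 p.2).
Proof.
rewrite /read_lists; apply: ptime_map; first by ptime_tac.
apply: ptime_map; last by ptime_tac.
by apply: (ptime_comp (ptime_segments comma)); ptime_tac.
Qed.

Lemma ptime_decide_lists :
  ptime (fun p : (seq letter * nat) * (seq (seq letter) * seq (seq nat)) =>
    decide_lists p.1.1 p.1.2 p.2.1 p.2.2).
Proof.
rewrite /decide_lists; apply: ptime_andb.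
  apply: ptime_all; first by ptime_tac.
  by apply: (ptime_comp2 (h := valid) ptime_valid); ptime_tac.
apply: ptime_andb; last by apply: (ptime_comp ptime_all_extendable); ptime_tac.
apply: ptime_eq_word; first by ptime_tac.
apply: (ptime_comp (ptime_terminated semicolon)).
apply: ptime_cons; first by ptime_tac.
apply: ptime_map; first by ptime_tac.
by apply: (ptime_comp2 (h := commas) ptime_commas); ptime_tac.
Qed.

Lemma ptime_decide_segments :
  ptime (fun p : seq letter * (nat * seq (seq letter)) =>
    decide_segments p.1 p.2.1 p.2.2).
Proof.
have tabP : ptime (fun p : seq letter * (nat * seq (seq letter)) =>
    numerals p.2.1).
  by apply: (ptime_comp ptime_numerals); ptime_tac.
apply: (ptime_comp (f := fun p : seq letter * (nat * seq (seq letter)) =>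
  ((p.1, p.2.1), (numerals p.2.1, read_lists (numerals p.2.1) p.2.2)))
  ptime_decide_lists).
apply: ptime_pair; first by ptime_tac.
apply: ptime_pair => //.
by apply: (ptime_comp2 (h := read_lists) ptime_read_lists) => //; ptime_tac.
Qed.

Lemma ptime_decide_word : ptime decide_word.
Proof.
have sP := ptime_segments semicolon.
have hP : ptime (fun w => head [::] (segments semicolon w)).
  by apply: ptime_head => //; ptime_tac.
rewrite /decide_word; apply: ptime_match.
- exact: ptime_behead.
- apply: ptime_andb; first exact: (ptime_comp ptime_is_numeral hP).
  apply: ptime_eq_word; first by ptime_tac.
  by apply: (ptime_comp (ptime_terminated semicolon)); ptime_tac.
apply: (ptime_comp3 (h := decide_segments) ptime_decide_segments).
- by ptime_tac.
- by apply: ptime_size; apply: (ptime_comp (ptime_segments comma)); ptime_tac.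
apply: ptime_behead; exact: (ptime_comp sP ptime_fst).
Qed.

Theorem theorem4p6 :
  in_P (fun w : seq letter =>
    exists (n k : nat) (a : k.-tuple (pbij n)),
      w = encode_instance a /\ factorizable (inverse_monoid_gen a)).
Proof.
have [M [p Mp]] := ptime_in_P ptime_decide_word.
exists M, p => w; have [t [b [le_t vt bw]]] := Mp w; exists t, b; split=> //.
exact: iff_trans bw (decide_wordP w).
Qed.
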